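(* For every Drinfeld $A$-module $\mathfrak d$ over $\mathbb{C}_\infty$ of rank $r\ge2$, with period lattice $\Lambda$, the de Rham morphism $\mathrm{DR}:H^1_{\mathrm{DR}}(\mathfrak d)\to\mathrm{Hom}_A(\Lambda,\mathbb{C}_\infty)$ is an isomorphism of $\mathbb{C}_\infty$-vector spaces.
   Context: Let $\mathbb{F}_q$ be the finite field with $q$ elements, $A=\mathbb{F}_q[\theta]$, $K_\infty=\mathbb{F}_q((\theta^{-1}))$, and $\mathbb{C}_\infty$ the completion of an algebraic closure of $K_\infty$. Let $\mathbb{C}_\infty\{\tau\}$ be the twisted polynomial ring, $\tau c=c^q\tau$, acting on $\mathbb{C}_\infty$ by $\tau(x)=x^q$. A Drinfeld module $\mathfrak d$ of rank $r$ over $\mathbb{C}_\infty$ is the $\mathbb{F}_q$-algebra map $A\to\mathbb{C}_\infty\{\tau\}$, $a\mapsto\mathfrak d_a$, determined by $\mathfrak d_\theta=\theta+g_1\tau+\cdots+g_{r-1}\tau^{r-1}+\Delta\tau^r$ with $\Delta\ne0$. Its exponential $e_{\mathfrak d}$ is the unique entire $\mathbb{F}_q$-linear function $e_{\mathfrak d}(w)=w+\cdots$ with $\mathfrak d_a(e_{\mathfrak d}(w))=e_{\mathfrak d}(aw)$ for all $a\in A$; $\Lambda=\ker e_{\mathfrak d}\subset\mathbb{C}_\infty$, an $A$-lattice of rank $r$. de Rham cohomology (Gekeler, Anderson). A biderivation is an $\mathbb{F}_q$-linear map $\delta:A\to\mathbb{C}_\infty\{\tau\}\tau$ with $\delta_{ab}=a\,\delta_b+\delta_a\mathfrak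 d_b$ for all $a,b\in A$. It is strictly inner if there is $n\in\mathbb{C}_\infty\{\tau\}\tau$ with $\delta_a=n\mathfrak d_a-an$ for all $a$. $H^1_{\mathrm{DR}}(\mathfrak d)$ is the $\mathbb{C}_\infty$-space of biderivations modulo strictly inner ones. It has as $\mathbb{C}_\infty$-basis the classes of the biderivations $\delta^{(0)},\delta^{(1)},\dots,\delta^{(r-1)}$ determined by $\theta\mapsto\mathfrak d_\theta-\theta,\ \tau,\ \dots,\ \tau^{r-1}$ respectively. de Rham morphism (cycle class map). To a biderivation $\delta$ is associated the unique $\mathbb{F}_q$-linear entire function $F_\delta$, with zero linear term, such that $F_\delta(\theta w)-\theta F_\delta(w)=\delta_\theta(e_{\mathfrak d}(w))$. Its restriction to $\Lambda$ is $A$-linear and depends only on the class of $\delta$; $\mathrm{DR}$ sends the class of $\delta$ to $F_\delta|_\Lambda$. Explicitly, $\delta^{(0)}\mapsto F_0(w)=e_{\mathfrak d}(w)-w$ and $\delta^{(k)}\mapsto F_k(w)=\sum_{i\ge0}\theta^ie_{\mathfrak d}(w\theta^{-i-1})^{q^k}$ for $1\le k\le r-1$ (restricted to $\Lambda$). *)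

(* Defs.v *)
From HB Require Import structures.
From mathcomp Require Import all_boot all_order all_algebra all_field.
From mathcomp Require Import ring_quotient.
From mathcomp Require abelian.
From mathcomp Require Import all_classical all_reals all_analysis.

Set Implicit Arguments.
Unset Strict Implicit.
Unset Printing Implicit Defensive.

Import Order.TTheory GRing.Theory Num.Theory.
Import numFieldNormedType.Exports.
Local Open Scope classical_set_scope.
Local Open Scope ring_scope.
Local Open Scope quotient_scope.

Section SkewMul.
Variables (C : comNzRingType) (sigma : {rmorphism C -> C}).

(** The product with t c = sigma(c) t, where t = 'X and coefficients are
    written on the left. *)
Definition skew_mul (p q : {poly C}) : {poly C} :=
  \sum_(i < size p) \sum_(j < size q) (p`_i * iter i sigma q`_j) *: 'X^(i + j).

Lemma iter_sigma0 i : iter i sigma 0 = 0.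
Proof. by elim: i => //= i ->; rewrite rmorph0. Qed.

Lemma iter_sigma1 i : iter i sigma 1 = 1.
Proof. by elim: i => //= i ->; rewrite rmorph1. Qed.

Lemma iter_sigmaD i : {morph iter i sigma : x y / x + y}.
Proof. by elim: i => // i IH x y /=; rewrite IH rmorphD. Qed.

Lemma iter_sigmaM i : {morph iter i sigma : x y / x * y}.
Proof. by elim: i => // i IH x y /=; rewrite IH rmorphM. Qed.

Lemma skew_mul_widen n m (p q : {poly C}) :
  (size p <= n)%N -> (size q <= m)%N ->
  skew_mul p q = \sum_(i < n) \sum_(j < m)
     (p`_i * iter i sigma (q`_j)) *: 'X^(i + j).
Proof.
move=> pn qm; rewrite /skew_mul.
rewrite (big_ord_widen n (fun i => \sum_(j < size q)
  (p`_i * iter i sigma (q`_j)) *: 'X^(i + j))) //.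
rewrite big_mkcond /=; apply: eq_bigr => i _.
case: ltnP => ip; last first.
  by rewrite big1 // => j _; rewrite nth_default // mul0r scale0r.
rewrite (big_ord_widen m (fun j =>
  (p`_i * iter i sigma (q`_j)) *: 'X^(i + j))) //.
rewrite big_mkcond /=; apply: eq_bigr => j _.
case: ltnP => jq //.
by rewrite [X in iter _ _ X]nth_default // iter_sigma0 mulr0 scale0r.
Qed.

Lemma skew_mulDl : left_distributive skew_mul +%R.
Proof.
move=> p q s; set n := maxn (size p) (size q).
rewrite (@skew_mul_widen n (size s)) ?size_polyD //.
rewrite (@skew_mul_widen n (size s) p) ?leq_maxl //.
rewrite (@skew_mul_widen n (size s) q) ?leq_maxr //.
rewrite -big_split; apply: eq_bigr => i _ /=.
rewrite -big_split; apply: eq_bigr => j _ /=.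
by rewrite coefD mulrDl scalerDl.
Qed.

Lemma skew_mulDr : right_distributive skew_mul +%R.
Proof.
move=> p q s; set n := maxn (size q) (size s).
rewrite (@skew_mul_widen (size p) n) ?size_polyD //.
rewrite (@skew_mul_widen (size p) n p q) ?leq_maxl //.
rewrite (@skew_mul_widen (size p) n p s) ?leq_maxr //.
rewrite -big_split; apply: eq_bigr => i _ /=.
rewrite -big_split; apply: eq_bigr => j _ /=.
by rewrite coefD iter_sigmaD mulrDr scalerDl.
Qed.

Lemma skew_mul0p p : skew_mul 0 p = 0.
Proof. by apply: (addrI (skew_mul 0 p)); rewrite -skew_mulDl !addr0. Qed.

Lemma skew_mulp0 p : skew_mul p 0 = 0.
Proof. by apply: (addrI (skew_mul p 0)); rewrite -skew_mulDr !addr0. Qed.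

Lemma skew_mul_suml (I : Type) (s : seq I) (f : I -> {poly C}) p :
  skew_mul (\sum_(i <- s) f i) p = \sum_(i <- s) skew_mul (f i) p.
Proof.
elim: s => [|i s IH]; first by rewrite !big_nil skew_mul0p.
by rewrite !big_cons skew_mulDl IH.
Qed.

Lemma skew_mul_sumr (I : Type) (s : seq I) (f : I -> {poly C}) p :
  skew_mul p (\sum_(i <- s) f i) = \sum_(i <- s) skew_mul p (f i).
Proof.
elim: s => [|i s IH]; first by rewrite !big_nil skew_mulp0.
by rewrite !big_cons skew_mulDr IH.
Qed.

Lemma skew_mul_monomial (a b : C) i j :
  skew_mul (a *: 'X^i) (b *: 'X^j) =
  (a * iter i sigma b) *: 'X^(i + j).
Proof.
have sz (c : C) k : (size (c *: 'X^k) <= k.+1)%N.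
  by rewrite (leq_trans (size_scale_leq _ _)) // size_polyXn.
rewrite (skew_mul_widen (sz a i) (sz b j)).
rewrite big_ord_recr /= big1 ?add0r; last first.
  move=> k _; rewrite big1 // => l _; rewrite coefZ coefXn.
  by rewrite (ltn_eqF (ltn_ord k)) mulr0 mul0r scale0r.
rewrite big_ord_recr /= big1 ?add0r; last first.
  move=> l _; rewrite !coefZ !coefXn.
  by rewrite (ltn_eqF (ltn_ord l)) mulr0 iter_sigma0 mulr0 scale0r.
by rewrite !coefZ !coefXn !eqxx !mulr1.
Qed.

Lemma skew_expand (p : {poly C}) :
  p = \sum_(i < size p) p`_i *: 'X^i :> {poly C}.
Proof. by rewrite -poly_def coefK. Qed.

Lemma skew_mulA : associative skew_mul.
Proof.
have expand (p : {poly C}) : exists n (P : nat -> C),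
    p = \sum_(i < n) P i *: 'X^i :> {poly C}.
  by exists (size p), (nth 0 p); exact: skew_expand.
move=> p q s; have [n [P ->]] := expand p.
have [m [Q ->]] := expand q; have [l [T ->]] := expand s.
transitivity (\sum_(i < n) \sum_(j < m) \sum_(k < l)
    skew_mul (P i *: 'X^i)
      (skew_mul (Q j *: 'X^j) (T k *: 'X^k))).
  rewrite skew_mul_suml; apply: eq_bigr => i _.
  rewrite skew_mul_suml skew_mul_sumr; apply: eq_bigr => j _.
  by rewrite [skew_mul (Q j *: _) _]skew_mul_sumr skew_mul_sumr.
transitivity (\sum_(i < n) \sum_(j < m) \sum_(k < l)
    skew_mul (skew_mul (P i *: 'X^i) (Q j *: 'X^j))
      (T k *: 'X^k)).
  apply: eq_bigr => i _; apply: eq_bigr => j _; apply: eq_bigr => k _.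
  by rewrite !skew_mul_monomial addnA iter_sigmaM mulrA -iterD.
have -> : skew_mul (\sum_(i < n) P i *: 'X^i)
                   (\sum_(j < m) Q j *: 'X^j) =
    \sum_(i < n) \sum_(j < m)
      skew_mul (P i *: 'X^i) (Q j *: 'X^j).
  by rewrite skew_mul_suml; apply: eq_bigr => i _; rewrite skew_mul_sumr.
rewrite skew_mul_suml; apply: eq_bigr => i _.
rewrite skew_mul_suml; apply: eq_bigr => j _.
by rewrite skew_mul_sumr.
Qed.

Lemma skew_mul1p : left_id 1 skew_mul.
Proof.
move=> p; rewrite {1}(skew_expand p).
have -> : (1 : {poly C}) = 1 *: ('X^0 : {poly C}) by rewrite scale1r expr0.
rewrite skew_mul_sumr [RHS]skew_expand; apply: eq_bigr => i _.
by rewrite skew_mul_monomial mul1r.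
Qed.

Lemma skew_mulp1 : right_id 1 skew_mul.
Proof.
move=> p; rewrite {1}(skew_expand p).
have -> : (1 : {poly C}) = 1 *: ('X^0 : {poly C}) by rewrite scale1r expr0.
rewrite skew_mul_suml [RHS]skew_expand; apply: eq_bigr => i _.
by rewrite skew_mul_monomial iter_sigma1 mulr1 addn0.
Qed.

Lemma skew_mulZl (c : C) p q : skew_mul (c *: p) q = c *: skew_mul p q.
Proof.
rewrite (skew_mul_widen (size_scale_leq c p) (leqnn (size q))) /skew_mul.
rewrite scaler_sumr; apply: eq_bigr => i _.
rewrite scaler_sumr; apply: eq_bigr => j _.
by rewrite scalerA mulrA coefZ.
Qed.

End SkewMul.

(** The ring C{t}; [{poly C}] is wrapped because its own product differs. *)
Record skewpoly (C : comNzRingType) (sigma : {rmorphism C -> C}) :=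
  SkewPoly { skew_val : {poly C} }.

Section SkewPoly.
Variables (C : comNzRingType) (sigma : {rmorphism C -> C}).
Local Notation S := (skewpoly sigma).

HB.instance Definition _ := [isNew for @skew_val C sigma].
HB.instance Definition _ := [Choice of S by <:].

Definition skew_coef (p : S) (i : nat) : C := (skew_val p)`_i.
Definition skew_size (p : S) : nat := size (skew_val p).

Definition skewpoly_zero : S := SkewPoly sigma 0.
Definition skewpoly_opp (p : S) : S := SkewPoly sigma (- skew_val p).
Definition skewpoly_add (p q : S) : S :=
  SkewPoly sigma (skew_val p + skew_val q).
Definition skewpoly_one : S := SkewPoly sigma 1.
Definition skewpoly_mul (p q : S) : S :=
  SkewPoly sigma (skew_mul sigma (skew_val p) (skew_val q)).
Definition skewpoly_scale (c : C) (p : S) : S :=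
  SkewPoly sigma (c *: skew_val p).

Lemma skewpoly_addA : associative skewpoly_add.
Proof. by move=> p q s; congr SkewPoly; rewrite /= addrA. Qed.

Lemma skewpoly_addC : commutative skewpoly_add.
Proof. by move=> p q; congr SkewPoly; rewrite /= addrC. Qed.

Lemma skewpoly_add0 : left_id skewpoly_zero skewpoly_add.
Proof. by move=> p; apply: val_inj; rewrite /= add0r. Qed.

Lemma skewpoly_addN : left_inverse skewpoly_zero skewpoly_opp skewpoly_add.
Proof. by move=> p; apply: val_inj; rewrite /= addNr. Qed.

HB.instance Definition _ := GRing.isZmodule.Build S
  skewpoly_addA skewpoly_addC skewpoly_add0 skewpoly_addN.

Lemma skewpoly_mulA : associative skewpoly_mul.
Proof. by move=> p q s; apply: val_inj; rewrite /= skew_mulA. Qed.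

Lemma skewpoly_mul1p : left_id skewpoly_one skewpoly_mul.
Proof. by move=> p; apply: val_inj; rewrite /= skew_mul1p. Qed.

Lemma skewpoly_mulp1 : right_id skewpoly_one skewpoly_mul.
Proof. by move=> p; apply: val_inj; rewrite /= skew_mulp1. Qed.

Lemma skewpoly_mulDl : left_distributive skewpoly_mul +%R.
Proof. by move=> p q s; apply: val_inj; rewrite /= skew_mulDl. Qed.

Lemma skewpoly_mulDr : right_distributive skewpoly_mul +%R.
Proof. by move=> p q s; apply: val_inj; rewrite /= skew_mulDr. Qed.

Lemma skewpoly_one_neq0 : skewpoly_one != 0.
Proof. by rewrite -val_eqE /= oner_neq0. Qed.

HB.instance Definition _ := GRing.Zmodule_isNzRing.Build S
  skewpoly_mulA skewpoly_mul1p skewpoly_mulp1 skewpoly_mulDl skewpoly_mulDr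
  skewpoly_one_neq0.

Lemma skewpoly_scaleA (a b : C) (p : S) :
  skewpoly_scale a (skewpoly_scale b p) = skewpoly_scale (a * b) p.
Proof. by apply: val_inj; rewrite /= scalerA. Qed.

Lemma skewpoly_scale1 : left_id 1 skewpoly_scale.
Proof. by move=> p; apply: val_inj; rewrite /= scale1r. Qed.

Lemma skewpoly_scaleDr : right_distributive skewpoly_scale +%R.
Proof. by move=> c p q; apply: val_inj; rewrite /= scalerDr. Qed.

Lemma skewpoly_scaleDl (p : S) :
  {morph skewpoly_scale^~ p : a b / a + b}.
Proof. by move=> a b; apply: val_inj; rewrite /= scalerDl. Qed.

HB.instance Definition _ := GRing.Zmodule_isLmodule.Build C S
  skewpoly_scaleA skewpoly_scale1 skewpoly_scaleDr skewpoly_scaleDl.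

Lemma skewpoly_scaleAl (c : C) (p q : S) : c *: (p * q) = (c *: p) * q.
Proof. by apply: val_inj; rewrite /= skew_mulZl. Qed.

HB.instance Definition _ :=
  GRing.LSemiModule_isLSemiAlgebra.Build C S skewpoly_scaleAl.

Definition skew_var : S := SkewPoly sigma 'X.

Lemma skew_varC (c : C) : skew_var * c%:A = (sigma c)%:A * skew_var.
Proof.
apply: val_inj; rewrite -scalerAl mul1r /=.
have := skew_mul_monomial sigma 1 c 1 0.
by rewrite !scale1r mul1r addn0 expr0 expr1.
Qed.

Lemma skew_coef0 i : skew_coef 0 i = 0.
Proof. exact: coef0. Qed.

Lemma skew_coefD p q i : skew_coef (p + q) i = skew_coef p i + skew_coef q i.
Proof. exact: coefD. Qed.

Lemma skew_coefZ c p i : skew_coef (c *: p) i = c * skew_coef p i.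
Proof. exact: coefZ. Qed.

(** The action of C{t} on C with t acting as sigma. *)
Definition skew_eval (p : S) (x : C) : C :=
  \sum_(i < skew_size p) skew_coef p i * iter i sigma x.

End SkewPoly.

(** Throughout, q = [#|F|] and A = [{poly F}], mapped to C by 'X |-> theta.
    The axioms make C contain F(theta) with |theta| = q. *)
Record valued_field (R : realType) (F : finFieldType) := ValuedField {
  vf_carrier :> closedFieldType;
  vf_const : {rmorphism F -> vf_carrier};
  theta : vf_carrier;
  vf_abs : vf_carrier -> R;
  vf_abs_ge0 : forall x, 0 <= vf_abs x;
  vf_abs_eq0 : forall x, vf_abs x = 0 <-> x = 0;
  vf_absM : forall x y, vf_abs (x * y) = vf_abs x * vf_abs y;
  vf_abs_ultra : forall x y,
    vf_abs (x + y) <= Num.max (vf_abs x) (vf_abs y);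
  vf_abs_theta : vf_abs theta = #|F|%:R }.

Arguments theta {R F} v.
Arguments vf_const {R F} v.
Arguments vf_abs {R F v}.

Section ValuedField.
Variables (R : realType) (F : finFieldType) (C : valued_field R F).

Definition converges_to (u : nat -> C) (l : C) : Prop :=
  vf_abs (u n - l) @[n --> \oo] --> (0 : R).

Definition cauchy_seq (u : nat -> C) : Prop :=
  forall e : R, 0 < e -> exists N : nat, forall m n : nat,
    (N <= m)%N -> (N <= n)%N -> vf_abs (u m - u n) < e.

(** K_oo = F((1/theta)), realised inside C as the set of the values of the
    Laurent series in 1/theta. *)
Definition K_infty : set C := [set x | exists (N : nat) (a : nat -> F),
  converges_to
    (fun n => theta C ^+ N * \sum_(i < n) vf_const C (a i) * theta C ^- i) x].

Definition algebraic_over_K_infty (x : C) : Prop :=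
  exists p : {poly C}, [/\ p != 0, forall i, K_infty p`_i & root p x].

End ValuedField.

(** The completion of an algebraic closure of K_oo, characterised (uniquely up
    to isometric isomorphism) as a complete, algebraically closed extension of
    K_oo in which the elements algebraic over K_oo are dense. *)
Record C_infty (R : realType) (F : finFieldType) := CInfty {
  ci_field :> valued_field R F;
  ci_complete : forall u : nat -> ci_field,
    cauchy_seq u -> exists l, converges_to u l;
  ci_dense : forall (x : ci_field) (e : R), 0 < e ->
    exists2 y, algebraic_over_K_infty y & vf_abs (x - y) < e }.

Section Drinfeld.
Variables (R : realType) (F : finFieldType) (C : C_infty R F).

Definition A_val (a : {poly F}) : C := (map_poly (vf_const C) a).[theta C].

Lemma A_valD : {morph A_val : a b / a + b}.
Proof. by move=> a b; rewrite /A_val rmorphD hornerD. Qed.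

Lemma A_valM : {morph A_val : a b / a * b}.
Proof. by move=> a b; rewrite /A_val rmorphM hornerM. Qed.

Lemma A_val1 : A_val 1 = 1.
Proof. by rewrite /A_val rmorph1 hornerC. Qed.

Lemma A_valX : A_val 'X = theta C.
Proof. by rewrite /A_val map_polyX hornerX. Qed.

Definition frobq (x : C) : C := x ^+ #|F|.

Lemma frobq_is_zmod_morphism : zmod_morphism frobq.
Proof.
have [p p_pr pF] := finPcharP F.
have pC : p \in [pchar C] by rewrite (fmorph_pchar (vf_const C)).
have qp : [pchar C].-nat #|F|.
  rewrite (eq_pnat _ (pcharf_eq pC)) -cardsT.
  exact: abelian.abelem_pgroup (abelian.fin_ring_pchar_abelem pF).
by move=> x y; rewrite /frobq exprDn_pchar // exprNn_pchar.
Qed.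

Lemma frobq_is_monoid_morphism : monoid_morphism frobq.
Proof. by split=> [|x y]; rewrite /frobq ?expr1n ?exprMn. Qed.

HB.instance Definition _ :=
  GRing.isZmodMorphism.Build C C frobq frobq_is_zmod_morphism.
HB.instance Definition _ :=
  GRing.isMonoidMorphism.Build C C frobq frobq_is_monoid_morphism.

(** C{tau}, with tau c = c^q tau and tau x = x^q. *)
Definition Ctau := skewpoly frobq.
HB.instance Definition _ := GRing.Lalgebra.on Ctau.

(** A rank r Drinfeld module: an F_q-algebra map A -> C{tau} with
    theta |-> theta + g_1 tau + ... + g_(r-1) tau^(r-1) + Delta tau^r,
    Delta <> 0. *)
Record drinfeld_module (r : nat) := DrinfeldModule {
  dm_map :> {rmorphism {poly F} -> Ctau};
  dm_const : forall c : F, dm_map c%:P = (vf_const C c)%:A;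
  dm_theta0 : skew_coef (dm_map 'X) 0 = theta C;
  dm_rank : skew_size (dm_map 'X) = r.+1 }.

Definition power_series_of (c : nat -> C) (f : C -> C) : Prop :=
  forall w, converges_to (fun n => \sum_(i < n) c i * w ^+ i) (f w).

Definition Fq_linear (f : C -> C) : Prop :=
  forall (a : F) (x y : C),
    f (vf_const C a * x + y) = vf_const C a * f x + f y.

(** F_q-linear entire functions whose linear term is [l * w]. *)
Definition Fq_entire (l : C) (f : C -> C) : Prop :=
  Fq_linear f /\ exists2 c : nat -> C, power_series_of c f & c 1%N = l.

Section DrinfeldModule.
Variables (r : nat) (d : drinfeld_module r).

Definition is_exponential (e : C -> C) : Prop :=
  Fq_entire 1 e /\
  forall (a : {poly F}) (w : C), skew_eval (d a) (e w) = e (A_val a * w).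

(** The function characterised by [is_exponential]; the value 0 of [xget] is a
    dummy for the case that there is none. *)
Definition dexp : C -> C := xget (fun=> 0) [set e | is_exponential e].

Definition period (w : C) : bool := dexp w == 0.

Lemma skew_eval0 (p : Ctau) : skew_eval p 0 = 0.
Proof.
by rewrite /skew_eval big1 // => i _; rewrite (iter_sigma0 frobq) mulr0.
Qed.

Lemma dexp_is_zmod_morphism : zmod_morphism dexp.
Proof.
rewrite /dexp; case: xgetP => [e _ [[elin _] _]|_] x y; last by rewrite subr0.
have /= := elin (- 1) y x.
by rewrite rmorphN rmorph1 !mulN1r ![- _ + _]addrC.
Qed.

Lemma period_A (a : {poly F}) (w : C) : period w -> period (A_val a * w).
Proof.
rewrite /period /dexp; case: xgetP => [e _ [_ <-] /eqP ->|_] //.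
by rewrite skew_eval0.
Qed.

Lemma period_zmod_closed : zmod_closed period.
Proof.
split=> [|x y].
  by apply/eqP; have := dexp_is_zmod_morphism 0 0; rewrite !subrr.
move=> /eqP x0 /eqP y0; apply/eqP.
by rewrite dexp_is_zmod_morphism x0 y0 subrr.
Qed.

HB.instance Definition _ := GRing.isZmodClosed.Build C period period_zmod_closed.

Record Lambda := Period { lam :> C; lamP : period lam }.

HB.instance Definition _ := [isSub for lam].
HB.instance Definition _ := [Choice of Lambda by <:].
HB.instance Definition _ := [SubChoice_isSubZmodule of Lambda by <:].

Definition Lambda_scale (a : {poly F}) (w : Lambda) : Lambda :=
  Period (period_A a (lamP w)).

Lemma Lambda_scaleA a b w :
  Lambda_scale a (Lambda_scale b w) = Lambda_scale (a * b) w.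
Proof. by apply: val_inj; rewrite /= A_valM mulrA. Qed.

Lemma Lambda_scale1 : left_id 1 Lambda_scale.
Proof. by move=> w; apply: val_inj; rewrite /= A_val1 mul1r. Qed.

Lemma Lambda_scaleDr : right_distributive Lambda_scale +%R.
Proof.
by move=> a x y; apply: val_inj; rewrite /= [LHS]mulrDr.
Qed.

Lemma Lambda_scaleDl w : {morph Lambda_scale^~ w : a b / a + b}.
Proof. by move=> a b; apply: val_inj; rewrite /= A_valD mulrDl. Qed.

HB.instance Definition _ := GRing.Zmodule_isLmodule.Build {poly F} Lambda
  Lambda_scaleA Lambda_scale1 Lambda_scaleDr Lambda_scaleDl.

Definition A_linear (f : Lambda -> C^o) : Prop :=
  forall (a : {poly F}) (x y : Lambda), f (a *: x + y) = A_val a * f x + f y.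

Definition A_linearb : {pred Lambda -> C^o} := fun f => `[< A_linear f >].

Lemma A_linear_submod_closed : submod_closed A_linearb.
Proof.
split=> [|c f g /asboolP flin /asboolP glin]; apply/asboolP => a x y.
  by rewrite -[LHS]/0 -[RHS]/(A_val a * 0 + 0) mulr0 addr0.
rewrite -[LHS]/(c * f (a *: x + y) + g (a *: x + y)).
rewrite -[RHS]/(A_val a * (c * f x + g x) + (c * f y + g y)).
by rewrite flin glin !mulrDr mulrCA addrACA.
Qed.

HB.instance Definition _ := GRing.isSubmodClosed.Build C (Lambda -> C^o)
  A_linearb A_linear_submod_closed.

Record HomA := HomMk { hom_fun :> Lambda -> C^o; homP : A_linearb hom_fun }.

HB.instance Definition _ := [isSub for hom_fun].
HB.instance Definition _ := [Choice of HomA by <:].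
HB.instance Definition _ := [SubChoice_isSubLmodule of HomA by <:].

Definition is_biderivation (delta : {poly F} -> Ctau) : Prop :=
  [/\ forall (c : F) (a b : {poly F}),
        delta (c *: a + b) = vf_const C c *: delta a + delta b,
      forall a, skew_coef (delta a) 0 = 0 &
      forall a b, delta (a * b) = A_val a *: delta b + delta a * d b].

Definition biderivationb : {pred {poly F} -> Ctau} :=
  fun delta => `[< is_biderivation delta >].

Lemma biderivation_submod_closed : submod_closed biderivationb.
Proof.
split=> [|c f g /asboolP[flin f0 fM] /asboolP[glin g0 gM]]; apply/asboolP.
  split=> [c a b|a|a b].
  - by rewrite -[LHS]/0 -[RHS]/(vf_const C c *: 0 + 0) scaler0 addr0.
  - exact: skew_coef0.
  - by rewrite -[LHS]/0 -[RHS]/(A_val a *: 0 + 0 * d b) scaler0 mul0r addr0.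
have fgE a : (c *: f + g) a = c *: f a + g a by [].
split=> [k a b|a|a b]; rewrite !fgE.
- rewrite flin glin !scalerDr !scalerA [vf_const C k * c]mulrC.
  exact: addrACA.
- by rewrite skew_coefD skew_coefZ f0 g0 mulr0 addr0.
- rewrite fM gM !scalerDr mulrDl !scalerA -scalerAl [c * _]mulrC.
  exact: addrACA.
Qed.

HB.instance Definition _ := GRing.isSubmodClosed.Build C ({poly F} -> Ctau)
  biderivationb biderivation_submod_closed.

Record biderivation := Biderivation {
  bider_fun :> {poly F} -> Ctau;
  biderP : biderivationb bider_fun }.

HB.instance Definition _ := [isSub for bider_fun].
HB.instance Definition _ := [Choice of biderivation by <:].
HB.instance Definition _ := [SubChoice_isSubLmodule of biderivation by <:].

Definition strictly_inner (delta : biderivation) : Prop :=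
  exists n : Ctau, skew_coef n 0 = 0 /\
    forall a, delta a = n * d a - A_val a *: n.

Definition strictly_innerb : {pred biderivation} :=
  fun delta => `[< strictly_inner delta >].

Lemma strictly_inner_submod_closed : submod_closed strictly_innerb.
Proof.
split=> [|c f g /asboolP[n [n0 fn]] /asboolP[m [m0 gm]]]; apply/asboolP.
  exists 0; split=> [|a]; first by rewrite skew_coef0.
  by rewrite mul0r scaler0 subr0.
exists (c *: n + m); split=> [|a].
  by rewrite skew_coefD skew_coefZ n0 m0 mulr0 addr0.
have -> : (c *: f + g : biderivation) a = c *: f a + g a by [].
rewrite fn gm mulrDl -scalerAl scalerBr !scalerDr !scalerA opprD.
by rewrite [A_val a * c]mulrC; exact: addrACA.
Qed.

HB.instance Definition _ := GRing.isSubmodClosed.Build C biderivation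
  strictly_innerb strictly_inner_submod_closed.

Definition H1DR := Quotient.quot strictly_innerb.
HB.instance Definition _ := GRing.Zmodule.on H1DR.
HB.instance Definition _ := EqQuotient.on H1DR.

Definition dR_class (delta : biderivation) : H1DR := \pi_H1DR delta.

Definition H1DR_scale (c : C) (x : H1DR) : H1DR := dR_class (c *: repr x).

Lemma dR_class_eq (x y : biderivation) :
  dR_class x = dR_class y <-> strictly_inner (x - y).
Proof.
split=> [/eqP|xy]; last apply/eqP.
  by rewrite /dR_class -Quotient.idealrBE => /asboolP.
by rewrite /dR_class -Quotient.idealrBE; apply/asboolP.
Qed.

Lemma dR_class_surj (x : H1DR) : exists delta, x = dR_class delta.
Proof. by exists (repr x); rewrite /dR_class reprK. Qed.

Lemma dR_classD x y : dR_class (x + y) = dR_class x + dR_class y.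
Proof. exact: (Quotient.pi_add strictly_innerb). Qed.

Lemma dR_classZ c x : H1DR_scale c (dR_class x) = dR_class (c *: x).
Proof.
apply/dR_class_eq; rewrite -scalerBr; apply/asboolP.
rewrite -/(strictly_innerb _); apply: (@rpredZ _ _ strictly_innerb); apply/asboolP.
by apply/dR_class_eq; rewrite /dR_class reprK.
Qed.

Lemma H1DR_scaleA a b x : H1DR_scale a (H1DR_scale b x) = H1DR_scale (a * b) x.
Proof. by have [y ->] := dR_class_surj x; rewrite !dR_classZ scalerA. Qed.

Lemma H1DR_scale1 : left_id 1 H1DR_scale.
Proof.
by move=> x; have [y ->] := dR_class_surj x; rewrite dR_classZ scale1r.
Qed.

Lemma H1DR_scaleDr : right_distributive H1DR_scale +%R.
Proof.
move=> c x y; have [x' ->] := dR_class_surj x; have [y' ->] := dR_class_surj y.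
by rewrite -dR_classD !dR_classZ scalerDr dR_classD.
Qed.

Lemma H1DR_scaleDl x : {morph H1DR_scale^~ x : a b / a + b}.
Proof.
move=> a b; have [y ->] := dR_class_surj x.
by rewrite !dR_classZ scalerDl dR_classD.
Qed.

HB.instance Definition _ := GRing.Zmodule_isLmodule.Build C H1DR
  H1DR_scaleA H1DR_scale1 H1DR_scaleDr H1DR_scaleDl.

Definition is_quasi_periodic (delta : biderivation) (f : C -> C) : Prop :=
  Fq_entire 0 f /\
  forall w, f (theta C * w) - theta C * f w = skew_eval (delta 'X) (dexp w).

(** The function F_delta; as for [dexp], the value 0 of [xget] is a dummy. *)
Definition F_delta (delta : biderivation) : C -> C :=
  xget (fun=> 0) [set f | is_quasi_periodic delta f].

Lemma F_delta_A_linear (delta : biderivation) :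
  A_linearb (fun w : Lambda => F_delta delta (lam w)).
Proof.
apply/asboolP; rewrite /F_delta; case: xgetP => [f _ [[flin _] ftheta]|_] a x y.
  have f0 : f 0 = 0.
    have := flin 1 0 0; rewrite rmorph1 !mul1r addr0 => /esym/eqP.
    by rewrite -subr_eq0 addrK => /eqP.
  have fD u v : f (u + v) = f u + f v.
    by have := flin 1 u v; rewrite rmorph1 !mul1r.
  have fA (b : {poly F}) w : period w -> f (A_val b * w) = A_val b * f w.
    elim/poly_ind: b w => [|b c IH] w wL.
      by rewrite /A_val rmorph0 horner0 !mul0r f0.
    have -> : A_val (b * 'X + c%:P) = A_val b * theta C + vf_const C c.
      by rewrite A_valD A_valM A_valX /A_val map_polyC hornerC.
    have tL : period (theta C * w) by rewrite -A_valX; exact: period_A.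
    have := ftheta w; rewrite (eqP wL) skew_eval0 => /eqP; rewrite subr_eq0.
    move=> /eqP ft; have := flin c w 0; rewrite f0 !addr0 => fc.
    by rewrite !mulrDl fD -!mulrA IH // ft fc.
  by rewrite -[lam _]/(A_val a * lam x + lam y) fD fA //; exact: lamP.
by rewrite mulr0 addr0.
Qed.

Definition dR_period (delta : biderivation) : HomA :=
  HomMk (F_delta_A_linear delta).

End DrinfeldModule.

End Drinfeld.

(* Main.v *)
(* Idea.  Write e = dexp d, and V for the kernel of d_theta on C_infty, an
   F_q-space with q^r elements.  Iterating the functional equation of F_delta gives
     F_delta(theta w) = sum_(m >= 0) theta^m delta_theta(e(w / theta^m)),
   hence uniqueness and linearity in delta, and a telescoping sum tending to 0
   on the lattice when delta is strictly inner.

   Modulo strictly inner biderivations delta_theta has the form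
   D = c_1 tau + ... + c_r tau^r.  The Newton polygon of e - v shows that each v
   is e(w) for some w such that all terms of e(w) have absolute value at most
   |v|, so that |e(w / theta^m)| <= |v| / q^m.  If v is in V then theta w is a
   period; if F_delta vanishes there, D(v) is minus the sum of the terms with
   m > 0, which are too small unless v is close to a root of the q-th root E of
   D, a polynomial of degree at most q^(r - 1).  Taking v in an orthogonal basis
   of V yields r independent roots of E over F_q, so E = 0: DR is injective.

   The periods theta w attached to the orthogonal basis of V generate the
   lattice, by a descent dividing absolute values by q.  Hence the values at r
   periods embed Hom_A(Lambda, C) in C^r, and DR is onto since the reduced D
   form a space of dimension r. *)
Require Import Defs.
From HB Require Import structures.
From mathcomp Require Import all_boot all_order all_algebra all_field.
From mathcomp Require Import all_classical all_reals all_analysis.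
From mathcomp Require Import ring lra zify.

Set Implicit Arguments.
Unset Strict Implicit.
Unset Printing Implicit Defensive.

Import Order.TTheory GRing.Theory Num.Theory.
Import numFieldNormedType.Exports.
Local Open Scope classical_set_scope.
Local Open Scope ring_scope.

Local Notation "<| x |>" := (vf_abs x) (at level 0, x at level 99).

(** * Geometric sequences of real numbers *)

Section RealPowers.
Variable R : realType.

Lemma expr_lt_eventually (x e : R) : 0 <= x < 1 -> 0 < e ->
  exists N : nat, forall n, (N <= n)%N -> x ^+ n < e.
Proof.
move=> /andP[x0 x1] e0.
have : `|x| < 1 by rewrite ger0_norm.
move=> /cvg_expr /cvgrPdist_lt /(_ e e0) [N _ HN].
by exists N => n /HN /=; rewrite sub0r normrN ger0_norm // exprn_ge0.
Qed.

End RealPowers.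

(** * Ultrametric estimates and limits *)

Section Ultrametric.
Variables (R : realType) (F : finFieldType) (C : valued_field R F).
Implicit Types (x y z : C) (u v : nat -> C).

Lemma vf_abs0 : <|0 : C|> = 0.
Proof. exact/vf_abs_eq0. Qed.

Lemma vf_abs_eq0b x : (<|x|> == 0) = (x == 0).
Proof. by apply/eqP/eqP => /vf_abs_eq0. Qed.

Lemma vf_abs_gt0 x : (0 < <|x|>) = (x != 0).
Proof. by rewrite lt_def vf_abs_eq0b vf_abs_ge0 andbT. Qed.

Lemma vf_abs1 : <|1 : C|> = 1.
Proof.
have /eqP := vf_absM (1 : C) 1; rewrite mulr1 -subr_eq0 -{1}[<|1|>]mulr1.
rewrite -mulrBr mulf_eq0 vf_abs_eq0b oner_eq0 /= subr_eq0.
by move=> /eqP.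
Qed.

Lemma vf_absX x n : <|x ^+ n|> = <|x|> ^+ n.
Proof. by elim: n => [|n IH]; rewrite ?expr0 ?vf_abs1 // !exprS vf_absM IH. Qed.

Lemma vf_absV x : <|x^-1|> = <|x|>^-1.
Proof.
have [->|x0] := eqVneq x 0; first by rewrite invr0 vf_abs0 invr0.
apply: (mulIf (x := <|x|>)); first by rewrite vf_abs_eq0b.
by rewrite -vf_absM !mulVf ?vf_abs1 // vf_abs_eq0b.
Qed.

Lemma vf_abs_root1 x n : (0 < n)%N -> x ^+ n = 1 -> <|x|> = 1.
Proof.
move=> n0 xn; apply/eqP; rewrite -(@pexpr_eq1 _ _ n) //; last exact: vf_abs_ge0.
by rewrite -vf_absX xn vf_abs1.
Qed.

Lemma vf_absN x : <|- x|> = <|x|>.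
Proof.
have N1 : <|-1 : C|> = 1 by apply: (@vf_abs_root1 _ 2) => //; rewrite sqrrN expr1n.
by rewrite -mulN1r vf_absM N1 mul1r.
Qed.

Lemma vf_abs_sub x y : <|x - y|> = <|y - x|>.
Proof. by rewrite -vf_absN opprB. Qed.

(** A nonzero constant satisfies a^(q - 1) = 1, so it is a root of unity. *)
Lemma vf_abs_const (a : F) : a != 0 -> <|vf_const C a|> = 1.
Proof.
move=> a0; have q1 := card_finNzRing_gt1 F.
apply: (@vf_abs_root1 _ #|F|.-1); first by rewrite -ltnS prednK // ltnW.
apply: (mulfI (x := vf_const C a)); first by rewrite fmorph_eq0.
by rewrite -exprS prednK ?(ltnW q1) // -rmorphXn expf_card mulr1.
Qed.

Lemma vf_absD_le x y B : <|x|> <= B -> <|y|> <= B -> <|x + y|> <= B.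
Proof.
by move=> xB yB; apply: le_trans (vf_abs_ultra x y) _; rewrite ge_max xB.
Qed.

Lemma vf_absB_le x y B : <|x|> <= B -> <|y|> <= B -> <|x - y|> <= B.
Proof. by move=> xB yB; apply: vf_absD_le; rewrite ?vf_absN. Qed.

Lemma vf_absD_lt x y B : <|x|> < B -> <|y|> < B -> <|x + y|> < B.
Proof.
by move=> xB yB; apply: le_lt_trans (vf_abs_ultra x y) _; rewrite gt_max xB.
Qed.

Lemma vf_absB_lt x y B : <|x|> < B -> <|y|> < B -> <|x - y|> < B.
Proof. by move=> xB yB; apply: vf_absD_lt; rewrite ?vf_absN. Qed.

Lemma vf_absD_eq x y : <|y|> < <|x|> -> <|x + y|> = <|x|>.
Proof.
move=> yx; apply/le_anti/andP; split; first by rewrite vf_absD_le // ltW.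
rewrite leNgt; apply/negP => lt.
by have := vf_absB_lt lt yx; rewrite addrK ltxx.
Qed.

Lemma vf_absD_eqr x y : <|x|> < <|y|> -> <|x + y|> = <|y|>.
Proof. by rewrite addrC; exact: vf_absD_eq. Qed.

Lemma vf_absB_eq x y : <|y|> < <|x|> -> <|x - y|> = <|x|>.
Proof. by move=> yx; rewrite vf_absD_eq // vf_absN. Qed.

Lemma vf_abs_sum_le (I : Type) (s : seq I) (P : pred I) (f : I -> C) B :
  0 <= B -> (forall i, P i -> <|f i|> <= B) -> <|\sum_(i <- s | P i) f i|> <= B.
Proof.
move=> B0 fB; elim/big_ind: _ => //; first by rewrite vf_abs0.
by move=> x y; exact: vf_absD_le.
Qed.

Lemma vf_abs_sum_lt (I : Type) (s : seq I) (P : pred I) (f : I -> C) B :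
  0 < B -> (forall i, P i -> <|f i|> < B) -> <|\sum_(i <- s | P i) f i|> < B.
Proof.
move=> B0 fB; elim/big_ind: _ => //; first by rewrite vf_abs0.
by move=> x y; exact: vf_absD_lt.
Qed.

Lemma vf_abs_theta_gt1 : 1 < <|theta C|>.
Proof. by rewrite vf_abs_theta ltr1n card_finNzRing_gt1. Qed.

Lemma theta_neq0 : theta C != 0.
Proof. by rewrite -vf_abs_gt0 (lt_trans _ vf_abs_theta_gt1). Qed.

Lemma vf_abs_thetaXB n : (1 < n)%N ->
  <|theta C ^+ n - theta C|> = <|theta C|> ^+ n.
Proof.
move=> n1; rewrite vf_absB_eq vf_absX //.
by rewrite -[X in X < _]expr1 ltr_eXn2l // vf_abs_theta_gt1.
Qed.

Lemma thetaXB_neq0 n : (1 < n)%N -> theta C ^+ n - theta C != 0.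
Proof.
move=> n1; rewrite -vf_abs_gt0 vf_abs_thetaXB // exprn_gt0 //.
exact: lt_trans vf_abs_theta_gt1.
Qed.

Lemma div_theta_small (B e : R) : 0 <= B -> 0 < e ->
  exists N, forall n, (N <= n)%N -> B / <|theta C|> ^+ n < e.
Proof.
move=> B0 e0; have t1 := vf_abs_theta_gt1; have t0 := lt_trans ltr01 t1.
(* The divisor is [B + 1] because [B] may be 0. *)
have e0' : 0 < e / (B + 1) by rewrite divr_gt0 // ltr_pwDr.
have [|N HN] := expr_lt_eventually (x := <|theta C|>^-1) _ e0'.
  by rewrite invr_ge0 vf_abs_ge0 invf_lt1.
exists N => n /HN; rewrite ltr_pdivlMr ?ltr_pwDr // => le.
apply: le_lt_trans le; rewrite -exprVn mulrC ler_wpM2l ?lerDl //.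
by rewrite exprn_ge0 // invr_ge0 ltW.
Qed.

Lemma converges_toP u x : converges_to u x <->
  forall e : R, 0 < e -> exists N : nat, forall n, (N <= n)%N -> <|u n - x|> < e.
Proof.
rewrite /converges_to; split=> [/cvgrPdist_lt ux e /ux [N _ HN]|ux].
  exists N => n /HN /=.
  by rewrite sub0r normrN ger0_norm ?vf_abs_ge0.
apply/cvgrPdist_lt => e /ux [N HN]; exists N => // n /HN /=.
by rewrite sub0r normrN ger0_norm ?vf_abs_ge0.
Qed.

Lemma converges_to_eq u v x :
  u =1 v -> converges_to u x -> converges_to v x.
Proof. by move=> /funext ->. Qed.

Lemma converges_to_cst x : converges_to (fun=> x) x.
Proof. by apply/converges_toP => e e0; exists 0%N => n _; rewrite subrr vf_abs0. Qed.

Lemma converges_toD u v x y : converges_to u x -> converges_to v y ->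
  converges_to (fun n => u n + v n) (x + y).
Proof.
move=> /converges_toP ux /converges_toP vy; apply/converges_toP => e e0.
have [N HN] := ux _ e0; have [M HM] := vy _ e0.
exists (maxn N M) => n; rewrite geq_max => /andP[/HN a /HM b].
by rewrite opprD addrACA vf_absD_lt.
Qed.

Lemma converges_toZ c u x : converges_to u x ->
  converges_to (fun n => c * u n) (c * x).
Proof.
move=> /converges_toP ux; apply/converges_toP => e e0.
have [->|c0] := eqVneq c 0.
  by exists 0%N => n _; rewrite !mul0r subrr vf_abs0.
rewrite -vf_abs_gt0 in c0.
have [N HN] := ux _ (divr_gt0 e0 c0).
by exists N => n /HN; rewrite -mulrBr vf_absM ltr_pdivlMr // mulrC.
Qed.

Lemma converges_toB u v x y : converges_to u x -> converges_to v y ->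
  converges_to (fun n => u n - v n) (x - y).
Proof.
move=> ux vy; rewrite -[- y]mulN1r.
apply: (converges_to_eq (u := fun n => u n + (-1) * v n)).
  by move=> n; rewrite mulN1r.
by apply: converges_toD => //; exact: converges_toZ.
Qed.

Lemma converges_to_sum (I : Type) (s : seq I) (u : I -> nat -> C) (l : I -> C) :
  (forall i, converges_to (u i) (l i)) ->
  converges_to (fun n => \sum_(i <- s) u i n) (\sum_(i <- s) l i).
Proof.
move=> ul; elim: s => [|i s IH].
  rewrite big_nil; apply: converges_to_eq (converges_to_cst 0).
  by move=> n; rewrite big_nil.
rewrite big_cons; apply: converges_to_eq (converges_toD (ul i) IH).
by move=> n; rewrite big_cons.
Qed.

Lemma converges_to_subseq (g : nat -> nat) u x :
  (forall n, (n <= g n)%N) -> converges_to u x -> converges_to (u \o g) x.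
Proof.
move=> gn /converges_toP ux; apply/converges_toP => e /ux [N HN].
by exists N => n Nn; apply: HN; apply: leq_trans (gn n).
Qed.

Lemma converges_to_abs_le u x y B N :
  (forall n, (N <= n)%N -> <|u n - y|> <= B) -> converges_to u x ->
  <|x - y|> <= B.
Proof.
move=> uB /converges_toP ux; rewrite leNgt; apply/negP => Bx.
have xy0 : 0 < <|x - y|>.
  by apply: le_lt_trans Bx; apply: le_trans (vf_abs_ge0 _) (uB N (leqnn N)).
have [M HM] := ux _ xy0.
have := HM _ (leq_maxr N M); have := uB _ (leq_maxl N M).
move=> /le_lt_trans/(_ Bx) a b.
have := vf_absB_lt a b; rewrite opprB addrC addrA subrK.
by rewrite ltxx.
Qed.

Lemma converges_to_abs_le0 u x B :
  (forall n, <|u n|> <= B) -> converges_to u x -> <|x|> <= B.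
Proof.
move=> uB /(@converges_to_abs_le _ _ 0 B 0%N); rewrite subr0; apply=> n _.
by rewrite subr0.
Qed.

Lemma converges_to_unique u x y :
  converges_to u x -> converges_to u y -> x = y.
Proof.
move=> ux uy; apply/eqP; rewrite -subr_eq0 -vf_abs_eq0b eq_le vf_abs_ge0 andbT.
apply: converges_to_abs_le0 (converges_toB ux uy).
by move=> n; rewrite subrr vf_abs0.
Qed.

Lemma converges_to_gt0_abs u x : x != 0 -> converges_to u x ->
  exists N, forall n, (N <= n)%N -> <|u n|> = <|x|>.
Proof.
rewrite -vf_abs_gt0 => x0 /converges_toP /(_ _ x0)[N HN].
by exists N => n /HN h; rewrite -[u n](subrK x) vf_absD_eqr.
Qed.

Lemma converges_to0_squeeze u (b : nat -> R) :
  (forall e, 0 < e -> exists N, forall n, (N <= n)%N -> b n < e) ->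
  (forall n, <|u n|> <= b n) -> converges_to u 0.
Proof.
move=> b0 ub; apply/converges_toP => e /b0 [N HN]; exists N => n /HN.
by rewrite subr0; exact: le_lt_trans.
Qed.

(** Ultrametric Cauchy criterion: it suffices to control consecutive differences. *)
Lemma vf_abs_sub_consec u e N :
  0 < e -> (forall n, (N <= n)%N -> <|u n.+1 - u n|> < e) ->
  forall m n, (N <= m)%N -> (N <= n)%N -> <|u m - u n|> < e.
Proof.
move=> e0 ue.
have {}ue m : (N <= m)%N -> <|u m - u N|> < e.
  move=> /subnK <-; elim: (m - N)%N => [|k IH]; first by rewrite subrr vf_abs0.
  rewrite addSn -[_ - u N](subrKA (u (k + N)%N)) vf_absD_lt // ue //.
  exact: leq_addl.
move=> m n Nm Nn; rewrite -[_ - u n](subrKA (u N)) vf_absD_lt ?ue //.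
by rewrite vf_abs_sub ue.
Qed.

End Ultrametric.

(** * Gauss norms, power series and twisted polynomials *)

Section GaussNorm.
Variables (R : realType) (F : finFieldType) (C : valued_field R F).

Lemma exists_min_seq (T : eqType) (f : T -> R) (s : seq T) : s != [::] ->
  exists2 w, w \in s & forall x, x \in s -> f w <= f x.
Proof.
elim: s => // a [|b s] IH _.
  by exists a; rewrite ?mem_head // => x; rewrite inE => /eqP ->.
have [//|w ws wmin] := IH; have [wa|aw] := leP (f w) (f a).
  exists w; first by rewrite inE ws orbT.
  by move=> x; rewrite inE => /predU1P[->|/wmin].
exists a; first by rewrite mem_head.
move=> x; rewrite inE => /predU1P[->//|/wmin]; exact/le_trans/ltW.
Qed.

Lemma vf_abs_prod_sub (rs : seq C) (v : C) :
  <|\prod_(z <- rs) (v - z)|> = \prod_(z <- rs) <|v - z|>.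
Proof.
elim: rs => [|z rs IH]; first by rewrite !big_nil vf_abs1.
by rewrite !big_cons vf_absM IH.
Qed.

(** The right-hand side is the Gauss norm of the product at radius [s]: each factor X - z has norm
    max(s, |z|), and the norm is submultiplicative. *)
Lemma gauss_norm_prod_XsubC (rs : seq C) (s : R) (i : nat) : 0 <= s ->
  <|(\prod_(z <- rs) ('X - z%:P))`_i|> * s ^+ i
    <= \prod_(z <- rs) Num.max s <|z|>.
Proof.
move=> s0; elim: rs i => [|z rs IH] i.
  rewrite !big_nil coef1; case: i => [|i] /=; first by rewrite vf_abs1 mulr1.
  by rewrite vf_abs0 mul0r.
rewrite !big_cons mulrBl coefB coefXM coefCM.
set p := \prod_(_ <- _) _ in IH *; set B := \prod_(_ <- _) _ in IH *.
have B0 : 0 <= B by apply: le_trans (IH 0%N); rewrite mulr_ge0 ?exprn_ge0 ?vf_abs_ge0.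
have up x : x <= Num.max s <|z|> -> x * B <= Num.max s <|z|> * B.
  by move=> ?; rewrite ler_wpM2r.
have zB : <|z * p`_i|> * s ^+ i <= Num.max s <|z|> * B.
  apply: le_trans (up <|z|> _); last by rewrite le_max lexx orbT.
  by rewrite vf_absM -mulrA ler_wpM2l ?vf_abs_ge0 // IH.
case: i zB => [|i] zB; first by rewrite sub0r vf_absN.
have pB : <|p`_i|> * s ^+ i.+1 <= Num.max s <|z|> * B.
  apply: le_trans (up s _); last by rewrite le_max lexx.
  by rewrite exprS mulrCA ler_wpM2l // IH.
(* Division by [s ^+ i.+1] requires a nonzero radius; at radius 0 the left-hand side vanishes. *)
have [/eqP|sn0] := boolP (s == 0).
  by move=> ->; rewrite exprS mul0r mulr0 mulr_ge0 // le_max lexx.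
have sp : 0 < s ^+ i.+1 by rewrite exprn_gt0 // lt_def sn0.
by rewrite -ler_pdivlMr //= vf_absB_le // ler_pdivlMr.
Qed.

Lemma gauss_norm_split (p : {poly C}) (rs : seq C) (s : R) (i : nat) :
  0 <= s -> p = lead_coef p *: \prod_(z <- rs) ('X - z%:P) ->
  <|p`_i|> * s ^+ i <= <|lead_coef p|> * \prod_(z <- rs) Num.max s <|z|>.
Proof.
move=> s0 {1}->; rewrite coefZ vf_absM -mulrA ler_wpM2l ?vf_abs_ge0 //.
exact: gauss_norm_prod_XsubC.
Qed.

Lemma horner_split (p : {poly C}) (rs : seq C) (v : C) :
  p = lead_coef p *: \prod_(z <- rs) ('X - z%:P) ->
  <|p.[v]|> = <|lead_coef p|> * \prod_(z <- rs) <|v - z|>.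
Proof.
move=> {1}->; rewrite hornerZ horner_prod vf_absM -vf_abs_prod_sub.
by under eq_bigr do rewrite hornerXsubC.
Qed.

Lemma root_split (p : {poly C}) (rs : seq C) (x : C) :
  p = lead_coef p *: \prod_(z <- rs) ('X - z%:P) -> x \in rs -> root p x.
Proof.
move=> -> xrs; rewrite /root hornerZ mulf_eq0 -/(root _ x) root_prod_XsubC xrs.
by rewrite orbT.
Qed.

(** If no root is closer to v than |v|, then |v - x| >= max(|v|, |x|) for every root x. Hence |p(v)|
    is at least the Gauss norm of p at radius |v|, which bounds every term. *)
Lemma exists_close_root (p : {poly C}) (v : C) (i : nat) :
  <|p.[v]|> < <|p`_i|> * <|v|> ^+ i ->
  exists2 x, root p x & <|v - x|> < <|v|>.
Proof.
have [rs pE] := closed_field_poly_normal p.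
apply: contraPP => far; apply/negP; rewrite -leNgt.
rewrite (horner_split v pE).
apply: le_trans (gauss_norm_split i (vf_abs_ge0 v) pE) _.
rewrite ler_wpM2l ?vf_abs_ge0 // big_seq [X in _ <= X]big_seq.
apply: ler_prod => x xrs; rewrite le_max vf_abs_ge0 /= ge_max.
have [vx|xv] := ltP <|v|> <|x|>.
  by rewrite vf_abs_sub vf_absB_eq // lexx ltW.
have vvx : <|v|> <= <|v - x|>.
  rewrite leNgt; apply/negP => lt; apply: far; exists x => //.
  exact: root_split pE xrs.
by rewrite vvx (le_trans xv).
Qed.

(** For a root w of least absolute value, max(|w|, |x|) = |x| for every root x, so the Gauss norm at
    radius |w| is |p(0)|. The size condition ensures that there is a root. *)
Lemma exists_min_root (p : {poly C}) : (1 < size p)%N ->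
  exists2 w, root p w & forall i, <|p`_i|> * <|w|> ^+ i <= <|p`_0|>.
Proof.
have [rs pE] := closed_field_poly_normal p => sp.
have rs0 : rs != [::].
  apply: contraTneq sp => rs0; rewrite pE rs0 big_nil -leqNgt.
  by rewrite -mul_polyC mulr1 size_polyC; case: eqP.
have [w wrs wmin] := exists_min_seq (fun z : C => <|z|>) rs0.
exists w => [|i]; first exact: root_split pE wrs.
apply: le_trans (gauss_norm_split i (vf_abs_ge0 w) pE) _.
rewrite -horner_coef0 (horner_split 0 pE) ler_wpM2l ?vf_abs_ge0 //.
rewrite big_seq [X in _ <= X]big_seq; apply: ler_prod => x xrs.
rewrite le_max vf_abs_ge0 /= sub0r vf_absN ge_max lexx andbT.
exact: wmin.
Qed.

End GaussNorm.

(** * Entire functions given by power series *)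

Section PowerSeries.
Variables (R : realType) (F : finFieldType) (C : C_infty R F).
Implicit Types (c : nat -> C) (f : C -> C) (w : C).
Local Notation q := #|F|.

Lemma q_gt1 : (1 < q)%N. Proof. exact: card_finNzRing_gt1. Qed.
Lemma q_gt0 : (0 < q)%N. Proof. exact: ltnW q_gt1. Qed.

Lemma power_series_term c f w : power_series_of c f ->
  converges_to (fun n => c n * w ^+ n) 0.
Proof.
move=> /(_ w) cf; rewrite -(subrr (f w)).
apply: (converges_to_eq (u := fun n =>
   \sum_(i < n.+1) c i * w ^+ i - \sum_(i < n) c i * w ^+ i)).
  by move=> n; rewrite big_ord_recr /= addrAC subrr add0r.
apply: converges_toB => //.
exact: (converges_to_subseq (g := succn) _ cf).
Qed.

Lemma bounded_of_converges (u : nat -> C) : converges_to u 0 ->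
  exists2 B : R, 0 < B & forall n, <|u n|> <= B.
Proof.
move=> /converges_toP /(_ 1 ltr01)[N HN].
exists (1 + \sum_(i < N) <|u i|>).
  by rewrite ltr_pwDl // sumr_ge0 // => i _; exact: vf_abs_ge0.
move=> n; have [/HN|nN] := leqP N n.
  rewrite subr0 => /ltW/le_trans; apply.
  by rewrite lerDl sumr_ge0 // => i _; exact: vf_abs_ge0.
rewrite (bigD1 (Ordinal nN)) //= addrCA lerDl addr_ge0 // sumr_ge0 // => i _.
exact: vf_abs_ge0.
Qed.

Lemma power_series_bounded c f w : power_series_of c f ->
  exists2 B : R, 0 < B & forall n, <|c n|> * <|w|> ^+ n <= B.
Proof.
move=> /(power_series_term w)/bounded_of_converges[B B0 cB].
by exists B => // n; rewrite -vf_absX -vf_absM.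
Qed.

Lemma power_series_tail_le c f w N B : power_series_of c f -> 0 <= B ->
  (forall n, (N <= n)%N -> <|c n|> * <|w|> ^+ n <= B) ->
  <|f w - \sum_(i < N) c i * w ^+ i|> <= B.
Proof.
move=> cf B0 cB; apply: (converges_to_abs_le (N := N)) (cf w) => n Nn.
rewrite -!(big_mkord xpredT (fun i => c i * w ^+ i)).
rewrite (big_cat_nat (n := N)) //= addrAC subrr add0r.
rewrite big_nat_cond; apply: vf_abs_sum_le => // i /andP[/andP[Ni _] _].
by rewrite vf_absM vf_absX cB.
Qed.

Lemma power_series_abs_le c f w B : power_series_of c f -> 0 <= B ->
  (forall n, <|c n|> * <|w|> ^+ n <= B) -> <|f w|> <= B.
Proof.
move=> cf B0 cB; have := power_series_tail_le (N := 0%N) cf B0 (fun n _ => cB n).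
by rewrite big_ord0 subr0.
Qed.

(** Some partial sum has exactly the absolute value of [f w], and an ultrametric sum cannot exceed
    all of its terms. *)
Lemma power_series_dominant c f w : power_series_of c f -> f w != 0 ->
  exists n, <|f w|> <= <|c n|> * <|w|> ^+ n.
Proof.
move=> cf fw0; have [N /(_ N (leqnn N)) fwE] := converges_to_gt0_abs fw0 (cf w).
apply: contrapT => no; have := lexx <|f w|>; rewrite -{2}fwE leNgt.
case/negP; apply: vf_abs_sum_lt; first by rewrite vf_abs_gt0.
move=> i _; rewrite ltNge vf_absM vf_absX; apply/negP => le.
by apply: no; exists i.
Qed.

(** In a complete ultrametric field a series converges as soon as its terms tend to 0. *)
Lemma power_series_exists c :
  (forall w, converges_to (fun n => c n * w ^+ n) 0) ->
  exists f, power_series_of c f.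
Proof.
move=> c0; have /choice[f Hf] : forall w, exists l,
    converges_to (fun n => \sum_(i < n) c i * w ^+ i) l; last by exists f.
move=> w; apply: ci_complete => e e0.
have /converges_toP/(_ e e0)[N HN] := c0 w; exists N => m n Nm Nn.
apply: (vf_abs_sub_consec (u := fun n => \sum_(i < n) c i * w ^+ i)) Nm Nn => //.
move=> k /HN; rewrite subr0 big_ord_recr /= addrAC subrr add0r; exact.
Qed.

Lemma power_series_at0 c f : power_series_of c f -> f 0 = c 0%N.
Proof.
move=> /(_ 0) cf; apply: converges_to_unique cf _.
apply/converges_toP => e e0; exists 1%N => -[|n] // _.
rewrite big_ord_recl /= expr0 mulr1 big1 ?addr0 ?subrr ?vf_abs0 // => i _.
by rewrite expr0n mulr0.
Qed.

Lemma power_series_scale_arg c f a : power_series_of c f ->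
  power_series_of (fun n => a ^+ n * c n) (fun w => f (a * w)).
Proof.
move=> cf w; apply: converges_to_eq (cf (a * w)) => n.
by apply: eq_bigr => i _; rewrite exprMn mulrA [c i * _]mulrC.
Qed.

Lemma power_series_unique c f g :
  power_series_of c f -> power_series_of c g -> f =1 g.
Proof. by move=> cf cg w; exact: converges_to_unique (cf w) (cg w). Qed.

Lemma power_seriesZ a c f : power_series_of c f ->
  power_series_of (fun n => a * c n) (fun w => a * f w).
Proof.
move=> cf w; apply: converges_to_eq (converges_toZ a (cf w)) => n.
by rewrite mulr_sumr; apply: eq_bigr => i _; rewrite mulrA.
Qed.

Lemma power_seriesB c f c' f' : power_series_of c f -> power_series_of c' f' ->
  power_series_of (fun n => c n - c' n) (fun w => f w - f' w).
Proof.
move=> cf cf' w; apply: converges_to_eq (converges_toB (cf w) (cf' w)) => n.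
by rewrite -sumrB; apply: eq_bigr => i _; rewrite mulrBl.
Qed.

Lemma power_series_sum m (c : nat -> nat -> C) (f : nat -> C -> C) :
  (forall k, power_series_of (c k) (f k)) ->
  power_series_of (fun n => \sum_(k < m) c k n) (fun w => \sum_(k < m) f k w).
Proof.
move=> cf w; apply: converges_to_eq
  (converges_to_sum (index_enum 'I_m) (fun k => cf k w)) => n.
rewrite exchange_big /=; apply: eq_bigr => i _.
by rewrite mulr_suml.
Qed.

(** The coefficients of the q-th power of a series, which is taken term by term since x |-> x^q is
    additive. *)
Definition frob_coefs c (n : nat) : C :=
  if (q %| n)%N then c (n %/ q)%N ^+ q else 0.

Lemma iter_frobq k x : iter k (@frobq R F C) x = x ^+ (q ^ k).
Proof. by elim: k => [|k IH] //=; rewrite IH /frobq -exprM expnSr. Qed.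

Lemma power_series_frob c f : power_series_of c f ->
  power_series_of (frob_coefs c) (fun w => frobq (f w)).
Proof.
(* [g n] is n / q rounded up, the number of multiples of q below n. *)
move=> cf w; pose g n := ((n + q.-1) %/ q)%N.
have gP n : \sum_(i < n) frob_coefs c i * w ^+ i =
    frobq (\sum_(i < g n) c i * w ^+ i).
  elim: n => [|n IH].
    by rewrite big_ord0 /g divn_small ?prednK ?q_gt0 // big_ord0 rmorph0.
  rewrite big_ord_recr /= IH /frob_coefs.
  have := q_gt0; case: ifP => [/dvdnP[k ->]|qn] qp.
    have gk : g (k * q)%N = k by rewrite /g divnMDl // divn_small ?addn0 ?prednK.
    have -> : g (k * q).+1 = k.+1.
      by rewrite /g addSnnS prednK // -mulSnr mulnK.
    rewrite mulnK // gk big_ord_recr /= rmorphD /=; congr (_ + _).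
    by rewrite [RHS]exprMn -exprM.
  rewrite mul0r addr0; suff -> : g n.+1 = g n by [].
  have b0 : (0 < n %% q)%N by rewrite lt0n; exact/negbT.
  have bq : (n %% q < q)%N by rewrite ltn_mod.
  have d1 x : (q <= x < q + q)%N -> (x %/ q = 1)%N.
    move=> /andP[qx xq]; apply/eqP; rewrite eqn_leq leq_divRL // mul1n qx.
    by rewrite -ltnS ltn_divLR // mulSn mul1n xq.
  rewrite /g (divn_eq n q) -addnS -!addnA !divnMDl //.
  by congr (_ + _)%N; rewrite !d1 //; lia.
apply: (converges_to_eq (u := fun n => frobq (\sum_(i < g n) c i * w ^+ i))).
  by move=> n; rewrite gP.
have gn n : (n <= q * g n)%N.
  rewrite /g mulnC; have := q_gt0 => qp; have := divn_eq (n + q.-1) q.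
  by have := ltn_pmod (n + q.-1) qp; lia.
have /converges_toP cfw := cf w; apply/converges_toP => e e0.
(* An error of absolute value at most 1 does not grow when raised to the power q. *)
have m0 : 0 < Num.min e 1 by rewrite lt_min e0 ltr01.
have [N HN] := cfw _ m0; exists (q * N)%N => n Nn.
rewrite -rmorphB vf_absX; have /HN : (N <= g n)%N.
  by rewrite -(leq_pmul2l q_gt0); exact: leq_trans Nn (gn n).
rewrite lt_min => /andP[lte lt1]; apply: le_lt_trans lte.
by rewrite -[X in _ <= X]expr1 ler_wiXn2l ?vf_abs_ge0 ?q_gt0 // ltW.
Qed.

End PowerSeries.

(** * Evaluation of twisted polynomials *)

Section SkewEval.
Variables (C : comNzRingType) (sigma : {rmorphism C -> C}).
Local Notation S := (skewpoly sigma).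
Implicit Types (p s : S) (x y : C).

Lemma skew_coef_default p i : (skew_size p <= i)%N -> skew_coef p i = 0.
Proof. by move=> pi; rewrite /skew_coef nth_default. Qed.

Lemma skewpolyP p s : skew_coef p =1 skew_coef s -> p = s.
Proof. by move=> ps; apply/val_inj/polyP => i; exact: ps. Qed.

Lemma skew_coef_sum (I : Type) (r : seq I) (f : I -> S) n :
  skew_coef (\sum_(i <- r) f i) n = \sum_(i <- r) skew_coef (f i) n.
Proof.
by elim: r => [|i r IH]; rewrite ?big_nil ?skew_coef0 // !big_cons skew_coefD IH.
Qed.

Lemma skew_eval_widen n p x : (skew_size p <= n)%N ->
  skew_eval p x = \sum_(i < n) skew_coef p i * iter i sigma x.
Proof.
move=> pn; rewrite /skew_eval (big_ord_widen n
  (fun i => skew_coef p i * iter i sigma x)) // big_mkcond /=.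
apply: eq_bigr => i _; case: ltnP => // pi.
by rewrite skew_coef_default // mul0r.
Qed.

Lemma skew_eval_is_zmod_morphism p : zmod_morphism (skew_eval p).
Proof.
move=> x y; rewrite /skew_eval -sumrB; apply: eq_bigr => i _.
rewrite -mulrBr; congr (_ * _).
by elim: (i : nat) => //= k ->; rewrite rmorphB.
Qed.

HB.instance Definition _ p :=
  GRing.isZmodMorphism.Build C C (skew_eval p) (skew_eval_is_zmod_morphism p).

Lemma skew_evalDl p s x : skew_eval (p + s) x = skew_eval p x + skew_eval s x.
Proof.
pose n := maxn (skew_size p) (skew_size s).
rewrite !(@skew_eval_widen n) ?leq_maxl ?leq_maxr ?size_polyD //.
rewrite -big_split; apply: eq_bigr => i _ /=.
by rewrite skew_coefD mulrDl.
Qed.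

Lemma skew_evalZl c p x : skew_eval (c *: p) x = c * skew_eval p x.
Proof.
rewrite (@skew_eval_widen (skew_size p)) ?size_scale_leq // mulr_sumr.
by apply: eq_bigr => i _; rewrite skew_coefZ mulrA.
Qed.

Lemma skew_eval0l x : skew_eval (0 : S) x = 0.
Proof. by rewrite /skew_eval /skew_size /= size_poly0 big_ord0. Qed.

Lemma skew_evalNl p x : skew_eval (- p) x = - skew_eval p x.
Proof. by apply/eqP; rewrite -addr_eq0 -skew_evalDl addNr skew_eval0l. Qed.

Lemma skew_eval_suml (I : Type) (r : seq I) (f : I -> S) x :
  skew_eval (\sum_(i <- r) f i) x = \sum_(i <- r) skew_eval (f i) x.
Proof.
by elim: r => [|i r IH]; rewrite ?big_nil ?skew_eval0l // !big_cons skew_evalDl IH.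
Qed.

Definition skew_monomial (c : C) (i : nat) : S := SkewPoly sigma (c *: 'X^i).

Lemma skew_monomialE c i n : skew_coef (skew_monomial c i) n = c *+ (n == i).
Proof. by rewrite /skew_coef coefZ coefXn mulr_natr. Qed.

Lemma skew_eval_monomial c i x :
  skew_eval (skew_monomial c i) x = c * iter i sigma x.
Proof.
rewrite (@skew_eval_widen i.+1).
  rewrite big_ord_recr /= big1 ?add0r ?skew_monomialE ?eqxx // => j _.
  by rewrite skew_monomialE (ltn_eqF (ltn_ord j)) mul0r.
by rewrite /skew_size /= (leq_trans (size_scale_leq _ _)) ?size_polyXn.
Qed.

Lemma skew_eval1l x : skew_eval (1 : S) x = x.
Proof.
have -> : (1 : S) = skew_monomial 1 0 by apply: val_inj; rewrite /= scale1r expr0.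
by rewrite skew_eval_monomial mul1r.
Qed.

Lemma skewpoly_expand p :
  p = \sum_(i < skew_size p) skew_monomial (skew_coef p i) i.
Proof.
apply: skewpolyP => n.
rewrite skew_coef_sum; under eq_bigr do rewrite skew_monomialE.
have [pn|np] := leqP (skew_size p) n.
  rewrite skew_coef_default // big1 // => i _.
  by rewrite (gtn_eqF (leq_trans (ltn_ord i) pn)).
rewrite (bigD1 (Ordinal np)) //= eqxx big1 ?addr0 // => i.
by rewrite -val_eqE eq_sym => /negPf /= ->.
Qed.

Lemma skew_monomialM a i b j :
  skew_monomial a i * skew_monomial b j = skew_monomial (a * iter i sigma b) (i + j).
Proof. by apply: val_inj; rewrite /= skew_mul_monomial. Qed.

Lemma skew_evalM p s x : skew_eval (p * s) x = skew_eval p (skew_eval s x).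
Proof.
rewrite [p]skewpoly_expand [s]skewpoly_expand mulr_suml !skew_eval_suml.
apply: eq_bigr => i _; rewrite mulr_sumr !skew_eval_suml raddf_sum.
apply: eq_bigr => j _; rewrite skew_monomialM !skew_eval_monomial /= -mulrA.
by rewrite skew_eval_monomial iterD (iter_sigmaM sigma).
Qed.

Lemma skew_monomial_mulE a i s n : skew_coef (skew_monomial a i * s) (i + n) =
  a * iter i sigma (skew_coef s n).
Proof.
rewrite [s in LHS]skewpoly_expand mulr_sumr skew_coef_sum.
under eq_bigr do rewrite skew_monomialM skew_monomialE eqn_add2l.
have [sn|ns] := leqP (skew_size s) n.
  rewrite skew_coef_default // (iter_sigma0 sigma) mulr0 big1 // => j _.
  by rewrite (gtn_eqF (leq_trans (ltn_ord j) sn)).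
rewrite (bigD1 (Ordinal ns)) //= eqxx big1 ?addr0 // => j.
by rewrite -val_eqE eq_sym => /negPf /= ->.
Qed.

End SkewEval.

(** * Twisted polynomials applied to power series *)

Section SkewPowerSeries.
Variables (R : realType) (F : finFieldType) (C : C_infty R F).
Implicit Types (c : nat -> C) (f : C -> C) (w : C).
Local Notation q := #|F|.

Lemma iter_frobq_const k (a : F) :
  iter k (@frobq R F C) (vf_const C a) = vf_const C a.
Proof. by elim: k => //= k ->; rewrite /frobq -rmorphXn expf_card. Qed.

Lemma power_series_iter_frob k c f : power_series_of c f ->
  power_series_of (iter k (@frob_coefs R F C) c) (fun w => iter k (@frobq R F C) (f w)).
Proof. by move=> cf; elim: k => //= k; exact: power_series_frob. Qed.

Definition skew_coefs (D : Ctau C) c (n : nat) : C :=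
  \sum_(k < skew_size D) skew_coef D k * iter k (@frob_coefs R F C) c n.

Lemma power_series_skew (D : Ctau C) c f : power_series_of c f ->
  power_series_of (skew_coefs D c) (fun w => skew_eval D (f w)).
Proof.
move=> cf; apply: (@power_series_sum _ _ _ _ (fun k n =>
   skew_coef D k * iter k (@frob_coefs R F C) c n) (fun k w =>
   skew_coef D k * iter k (@frobq R F C) (f w))) => k.
exact/power_seriesZ/power_series_iter_frob.
Qed.

Lemma iter_frob_coefs0 k c : iter k (@frob_coefs R F C) c 0%N = c 0%N ^+ (q ^ k).
Proof.
elim: k => [|k IH] /=; first by rewrite expr1.
by rewrite /frob_coefs dvdn0 div0n IH -exprM expnSr.
Qed.

Lemma iter_frob_coefs1 k c : (0 < k)%N -> iter k (@frob_coefs R F C) c 1%N = 0.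
Proof.
case: k => // k _ /=; rewrite /frob_coefs dvdn1.
by have := q_gt1 F; case: eqP => // ->.
Qed.

Lemma iter_frob_coefs_ext k c c' n : (forall m, (m <= n)%N -> c m = c' m) ->
  iter k (@frob_coefs R F C) c n = iter k (@frob_coefs R F C) c' n.
Proof.
elim: k c c' n => [|k IH] c c' n cc' /=; first exact: cc'.
rewrite /frob_coefs; case: ifP => // _; rewrite (IH c c') // => m mn.
by apply: cc'; rewrite (leq_trans mn) // leq_div.
Qed.

(** After at least one Frobenius, the coefficient of index n depends only on indices up to n / q,
    which is less than n. This makes the recursion for the exponential well founded. *)
Lemma iterS_frob_coefs_ext k c c' n : (0 < n)%N ->
  (forall m, (m < n)%N -> c m = c' m) ->
  iter k.+1 (@frob_coefs R F C) c n = iter k.+1 (@frob_coefs R F C) c' n.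
Proof.
move=> n0 cc'; rewrite !iterSr; apply: iter_frob_coefs_ext => m mn.
rewrite /frob_coefs; case: ifP => // _; rewrite cc' //.
have [->|m0] := posnP m; first by rewrite div0n.
by rewrite (leq_trans _ mn) // ltn_Pdiv // q_gt1.
Qed.

(** A geometric bound survives the Frobenius, as |c_m|^(q^k) <= s^(m q^k); only the threshold is
    multiplied by q^k. *)
Lemma iter_frob_coefs_le k c (s : R) N : 0 <= s ->
  (forall m, (N <= m)%N -> <|c m|> <= s ^+ m) ->
  forall n, (N * q ^ k <= n)%N -> <|iter k (@frob_coefs R F C) c n|> <= s ^+ n.
Proof.
move=> s0 cs; elim: k => [|k IH] n /=; first by rewrite muln1; exact: cs.
move=> nk; rewrite /frob_coefs; case: ifPn => [/dvdnP[m nE]|_]; last first.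
  by rewrite vf_abs0 exprn_ge0.
subst n; rewrite mulnK ?q_gt0 // vf_absX exprM lerXn2r ?nnegrE ?vf_abs_ge0 ?exprn_ge0 //.
by apply: IH; rewrite -(leq_pmul2r (q_gt0 F)) -mulnA -expnSr.
Qed.

Lemma Fq_linear_lim (u : nat -> C -> C) f : (forall n, Fq_linear (u n)) ->
  (forall w, converges_to (fun n => u n w) (f w)) -> Fq_linear f.
Proof.
move=> ulin uf a x y; apply: converges_to_unique (uf _) _.
apply: converges_to_eq (converges_toD (converges_toZ (vf_const C a) (uf x)) (uf y)).
by move=> n; rewrite ulin.
Qed.

Lemma Fq_linear_sum (I : Type) (s : seq I) (u : I -> C -> C) :
  (forall i, Fq_linear (u i)) -> Fq_linear (fun w => \sum_(i <- s) u i w).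
Proof.
move=> ulin a x y; rewrite mulr_sumr -big_split; apply: eq_bigr => i _ /=.
exact: ulin.
Qed.

Lemma Fq_linear_skew_eval (D : Ctau C) : Fq_linear (skew_eval D).
Proof.
move=> a x y; rewrite raddfD; congr (_ + _).
rewrite /skew_eval mulr_sumr; apply: eq_bigr => i _.
by rewrite (iter_sigmaM (@frobq R F C)) iter_frobq_const mulrCA.
Qed.

Lemma Fq_linearB f : Fq_linear f -> zmod_morphism f.
Proof.
move=> flin x y; have := flin (- 1) y x.
by rewrite rmorphN rmorph1 !mulN1r ![- _ + _]addrC.
Qed.

Lemma course_of_values (Phi : nat -> (nat -> C) -> C) :
  (forall n c c', (forall m, (m < n)%N -> c m = c' m) -> Phi n c = Phi n c') ->
  exists c, forall n, c n = Phi n c.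
Proof.
move=> ext; pose a := fix a k := if k is k'.+1 then fun n => Phi n (a k') else fun=> 0.
have stable k l n : (n < k)%N -> (n < l)%N -> a k n = a l n.
  elim: k l n => [|k IH] [|l] n //; rewrite !ltnS => nk nl /=.
  apply: ext => m mn; apply: IH; exact: leq_trans mn _.
exists (fun n => a n.+1 n) => n; apply: ext => m mn.
exact: (stable n m.+1 m).
Qed.

Lemma Fq_linear_monomial b j : Fq_linear (fun w : C => b * w ^+ (q ^ j)).
Proof.
move=> a x y; rewrite -!(iter_frobq j) (iter_sigmaD (@frobq R F C)).
by rewrite (iter_sigmaM (@frobq R F C)) iter_frobq_const mulrDr mulrCA.
Qed.

End SkewPowerSeries.

(** * The exponential and quasi-periodic functions *)

Section Exponential.
Variables (R : realType) (F : finFieldType) (C : C_infty R F).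
Implicit Types (c : nat -> C) (f : C -> C) (w : C).
Local Notation q := #|F|.
Local Notation frobs := (@frob_coefs R F C).

Lemma iter_frob_coefs_support k c n : iter k frobs c n != 0 ->
  exists2 m, n = (m * q ^ k)%N & c m != 0.
Proof.
elim: k n => [|k IH] n /=; first by move=> cn; exists n; rewrite ?muln1.
rewrite {1}/frob_coefs; case: ifP => [/dvdnP[l ->]|]; last by rewrite eqxx.
rewrite mulnK ?q_gt0 // expf_eq0 q_gt0 /= => /IH[m -> cm].
by exists m; rewrite // expnSr mulnA.
Qed.

(* Here [g k] is the coefficient of [tau ^ k.+1] in the image of [theta]. *)
Section Coefficients.
Variables (r : nat) (g : nat -> C).

(** The recursion compares the coefficients of w^n in e(theta w) = d_theta(e(w)). It can be solved
    for c_n because theta^n - theta is nonzero for n > 1 and the right-hand side involves smaller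
    indices only. *)
Lemma exp_coefs_exist : exists c, [/\ c 0%N = 0, c 1%N = 1 &
  forall n, (1 < n)%N ->
    (theta C ^+ n - theta C) * c n = \sum_(k < r) g k * iter k.+1 frobs c n].
Proof.
pose Phi n c := if (n <= 1)%N then n%:R else
  (\sum_(k < r) g k * iter k.+1 frobs c n) / (theta C ^+ n - theta C).
have [c cE] : exists c, forall n, c n = Phi n c.
  apply: course_of_values => n c c' cc'; rewrite /Phi; case: leqP => // n1.
  congr (_ / _); apply: eq_bigr => k _.
  by rewrite (iterS_frob_coefs_ext _ (ltnW n1) cc').
exists c; split=> [||n n1]; rewrite cE /Phi //.
by rewrite leqNgt n1 /= mulrC divfK // thetaXB_neq0.
Qed.

Variable c : nat -> C.
Hypotheses (c0 : c 0%N = 0) (c1 : c 1%N = 1).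
Hypothesis cE : forall n, (1 < n)%N ->
  (theta C ^+ n - theta C) * c n = \sum_(k < r) g k * iter k.+1 frobs c n.

(** A nonzero c_n with n > 1 comes from a nonzero c_l with n = l q^(k + 1), so strong induction
    applies. This support is what makes the sum of the series F_q-linear. *)
Lemma exp_coefs_support n : c n != 0 -> exists j, n = (q ^ j)%N.
Proof.
have [m] := ubnP n; elim: m n => // m IH n; rewrite ltnS => nm cn.
have [n1|n1] := leqP n 1.
  exists 0%N; case: n n1 cn {nm} => [|[|]] //; by rewrite c0 eqxx.
have [k gk] : exists k : 'I_r, g k * iter k.+1 frobs c n != 0.
  apply: contrapT => no; have : (theta C ^+ n - theta C) * c n == 0.
    rewrite cE // big1 // => k _; apply/eqP/negPn/negP => ?.
    by apply: no; exists k.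
  by rewrite mulf_eq0 (negPf cn) (negPf (thetaXB_neq0 _ n1)).
have : iter k.+1 frobs c n != 0 by apply: contra gk => /eqP ->; rewrite mulr0.
move=> /iter_frob_coefs_support[l nE cl].
have ln : (l < n)%N.
  have l0 : (0 < l)%N by rewrite lt0n; apply: contra cl => /eqP ->; rewrite c0.
  by rewrite nE -[X in (X < _)%N]muln1 ltn_pmul2l // -(exp1n k.+1) ltn_exp2r // q_gt1.
have [j lE] := IH l (leq_trans ln nm) cl.
by exists (j + k.+1)%N; rewrite nE {1}lE expnD.
Qed.

Let bound : R := 1 + \sum_(k < r) <|g k|>.

Let bound_gt0 : 0 < bound.
Proof. by rewrite ltr_pwDl // sumr_ge0 // => k _; exact: vf_abs_ge0. Qed.

Lemma exp_coefs_step n (B : R) : (1 < n)%N -> 0 <= B ->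
  (forall k : 'I_r, <|iter k.+1 frobs c n|> <= B) ->
  <|c n|> <= bound * B / <|theta C|> ^+ n.
Proof.
move=> n1 B0 cB; have t0 := lt_trans ltr01 (vf_abs_theta_gt1 C).
rewrite ler_pdivlMr ?exprn_gt0 // mulrC -vf_abs_thetaXB // -vf_absM cE //.
apply: vf_abs_sum_le => [|k _]; first by rewrite mulr_ge0 // ltW.
rewrite vf_absM ler_pM ?vf_abs_ge0 // /bound (bigD1 k) //= addrCA lerDl.
by rewrite addr_ge0 // sumr_ge0 // => i _; exact: vf_abs_ge0.
Qed.

(** Once bound / |theta|^n is below 1 the recursion preserves the bound T^n; [T] is chosen above the
    finitely many earlier coefficients. *)
Lemma exp_coefs_bounded : exists2 T : R, 1 <= T & forall n, <|c n|> <= T ^+ n.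
Proof.
have [N HN] := div_theta_small C (ltW bound_gt0) ltr01.
pose T : R := 1 + \sum_(i < N) <|c i|>.
have S0 (P : pred 'I_N) : 0 <= \sum_(i < N | P i) <|c i|>.
  by apply: sumr_ge0 => i _; exact: vf_abs_ge0.
have T1 : 1 <= T by rewrite lerDl.
have T0 : 0 <= T := le_trans ler01 T1.
exists T => // n; have [m] := ubnP n; elim: m n => // m IH n; rewrite ltnS => nm.
have [|n1] := leqP n 1.
  case: n {nm} => [|[|//]] _; first by rewrite c0 vf_abs0.
  by rewrite c1 vf_abs1.
have [Nn|nN] := leqP N n; last first.
  apply: (le_trans (y := T)); last by rewrite -[X in X <= _]expr1 ler_weXn2l // ltnW.
  by rewrite /T (bigD1 (Ordinal nN)) //= addrCA lerDl addr_ge0.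
apply: (le_trans (y := bound * T ^+ n / <|theta C|> ^+ n)); last first.
  by rewrite mulrAC ler_piMl ?exprn_ge0 // ltW // HN.
apply: exp_coefs_step => [//||k]; first exact: exprn_ge0.
(* The induction hypothesis covers only indices below n; truncating there does not change the
   right-hand side of the recursion. *)
pose c' i := if (i < n)%N then c i else 0.
rewrite (@iterS_frob_coefs_ext _ _ _ _ _ c') ?(ltnW n1) //; last first.
  by move=> i; rewrite /c' => ->.
apply: (@iter_frob_coefs_le _ _ _ _ _ _ 0%N) => // i _; rewrite /c'.
case: ifP => [lti|_]; last by rewrite vf_abs0 exprn_ge0.
exact: IH (leq_trans lti nm).
Qed.

(** One use of the recursion gains the factor bound / |theta|^n. As |theta| >= 2, this is at most
    (3/4)^n as soon as (2/3)^n < 1 / bound. *)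
Lemma exp_coefs_decay (s : R) : 0 <= s ->
  (exists N, forall n, (N <= n)%N -> <|c n|> <= s ^+ n) ->
  exists N, forall n, (N <= n)%N -> <|c n|> <= (s * (3 / 4)) ^+ n.
Proof.
move=> s0 [N cN].
have [||N' HN'] := expr_lt_eventually (x := 2 / 3 : R) (e := bound^-1).
- by apply/andP; split; lra.
- by rewrite invr_gt0.
exists (maxn 2 (maxn N' (N * q ^ r))) => n.
rewrite !geq_max => /and3P[n2 /HN' lt nN].
apply: (le_trans (y := bound * s ^+ n / <|theta C|> ^+ n)).
  apply: exp_coefs_step => [//||k]; first exact: exprn_ge0.
  apply: iter_frob_coefs_le s0 cN _ _; apply: leq_trans nN.
  by rewrite leq_mul2l leq_pexp2l ?orbT // q_gt0.
have t0 := lt_trans ltr01 (vf_abs_theta_gt1 C).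
rewrite ler_pdivrMr ?exprn_gt0 // exprMn [bound * _]mulrC -mulrA ler_wpM2l ?exprn_ge0 //.
have q2 : 2 <= <|theta C|> by rewrite vf_abs_theta ler_nat q_gt1.
apply: (le_trans (y := (3 / 4 * 2) ^+ n)).
  have -> : 3 / 4 * 2 = (2 / 3 : R)^-1 by field.
  have p0 : 0 < (2 / 3 : R) ^+ n by rewrite exprn_gt0 //; lra.
  rewrite exprVn -[X in _ <= X]mul1r ler_pdivlMr // ltW //.
  by rewrite -ltr_pdivlMl // mulr1.
rewrite [(_ / _ * 2) ^+ n]exprMn ler_wpM2l //.
by apply: lerXn2r => //; rewrite nnegrE ?vf_abs_ge0.
Qed.

(** Repeated decay gives |c_n| <= (T (3/4)^j)^n eventually, for each j. With j so large that T
    (3/4)^j |w| <= 1/2, the terms are eventually at most (1/2)^n. *)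
Lemma exp_coefs_entire w : converges_to (fun n => c n * w ^+ n) 0.
Proof.
have [T T1 cT] := exp_coefs_bounded; have T0 := le_trans ler01 T1.
have dec j : exists N, forall n, (N <= n)%N -> <|c n|> <= (T * (3 / 4) ^+ j) ^+ n.
  elim: j => [|j IH]; first by exists 0%N => n _; rewrite expr0 mulr1.
  have -> : T * (3 / 4) ^+ j.+1 = T * (3 / 4) ^+ j * (3 / 4) by rewrite exprSr -[RHS]mulrA.
  apply: (exp_coefs_decay _ IH).
  by rewrite mulr_ge0 // exprn_ge0 //; lra.
have w1 : 0 < T * (<|w|> + 1) * 2.
  by rewrite !mulr_gt0 ?(lt_le_trans ltr01 T1) // ltr_pwDr // vf_abs_ge0.
have [||j Hj] := expr_lt_eventually (x := 3 / 4 : R) (e := (T * (<|w|> + 1) * 2)^-1).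
- by apply/andP; split; lra.
- by rewrite invr_gt0.
have {Hj} := Hj j (leqnn j); set s := _ ^+ j => sj.
have s0 : 0 <= s by rewrite exprn_ge0 //; lra.
have sw : T * s * <|w|> <= 1 / 2.
  have : s * (T * (<|w|> + 1) * 2) < 1 by rewrite -ltr_pdivlMr // div1r.
  have := mulr_ge0 T0 s0; have := vf_abs_ge0 w; nra.
have [N HN] := dec j; apply/converges_toP => e e0.
have [|N' HN'] := expr_lt_eventually (x := 1 / 2 : R) _ e0.
  by apply/andP; split; lra.
exists (maxn N N') => n; rewrite geq_max => /andP[/HN cn /HN' lt].
rewrite subr0; apply: le_lt_trans lt; rewrite vf_absM vf_absX.
apply: (le_trans (y := (T * s * <|w|>) ^+ n)).
  by rewrite [X in _ <= X]exprMn ler_wpM2r // exprn_ge0 // vf_abs_ge0.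
by rewrite lerXn2r // nnegrE ?mulr_ge0 ?vf_abs_ge0 //; lra.
Qed.

Lemma exp_coefs_Fq_linear f : power_series_of c f -> Fq_linear f.
Proof.
move=> cf; apply: Fq_linear_lim cf => n; apply: Fq_linear_sum => i.
have [->|/exp_coefs_support[j ->]] := eqVneq (c i) 0; last exact: Fq_linear_monomial.
by move=> a x y; rewrite !mul0r mulr0 addr0.
Qed.

End Coefficients.

Section DrinfeldExponential.
Variables (r : nat) (d : drinfeld_module C r).

Lemma skew_eval_scalar (a x : C) : skew_eval (a%:A : Ctau C) x = a * x.
Proof. by rewrite skew_evalZl skew_eval1l. Qed.

Lemma exponential_exists : exists e, is_exponential d e.
Proof.
pose g k := skew_coef (d 'X) k.+1.
have [c [c0 c1 cE]] := exp_coefs_exist r g.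
have [e ce] := power_series_exists (@exp_coefs_entire r g c c0 c1 cE).
have elin := @exp_coefs_Fq_linear r g c c0 cE e ce.
have etheta w : skew_eval (d 'X) (e w) = e (theta C * w).
  apply: (power_series_unique (g := fun w => e (theta C * w))
    (power_series_skew (d 'X) ce)).
  suff -> : skew_coefs (d 'X) c = fun n => theta C ^+ n * c n.
    exact: power_series_scale_arg.
  apply/funext => n; rewrite /skew_coefs (dm_rank d) big_ord_recl /= dm_theta0.
  (* The recursion starts at index 2. At indices 0 and 1 the positive powers of tau contribute
     nothing. *)
  have [n1|/cE <-] := leqP n 1; last by rewrite -mulrDl addrC subrK.
  rewrite big1 ?addr0 => [|k _].
    by case: n n1 => [|[|//]] _; rewrite ?c0 ?mulr0 // expr1.
  rewrite -[frobs _]/(iter k.+1 frobs c); case: n n1 => [|[|//]] _; last by rewrite iter_frob_coefs1 ?mulr0.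
  by rewrite iter_frob_coefs0 c0 expr0n expn_eq0 gtn_eqF ?q_gt0 //= mulr0.
exists e; split; first by split=> //; exists c.
(* The functional equation at theta extends to all of A by Horner induction on the polynomial. *)
elim/poly_ind => [|p b IH] w.
  rewrite rmorph0 skew_eval0l /A_val rmorph0 horner0 mul0r.
  by have := Fq_linearB elin 0 0; rewrite !subrr.
rewrite rmorphD rmorphM /= dm_const skew_evalDl skew_evalM skew_eval_scalar.
rewrite etheta IH A_valD A_valM A_valX /A_val map_polyC hornerC.
rewrite mulrDl -mulrA [LHS]addrC -elin; congr e; exact: addrC.
Qed.

Lemma dexpP : is_exponential d (dexp d).
Proof. exact: (@xgetPex _ _ [set e | is_exponential d e]) exponential_exists. Qed.

Lemma dexp_lin : Fq_linear (dexp d).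
Proof. by have [[]] := dexpP. Qed.

HB.instance Definition _ :=
  GRing.isZmodMorphism.Build C C (dexp d) (dexp_is_zmod_morphism d).

Lemma dexp_theta w : dexp d (theta C * w) = skew_eval (d 'X) (dexp d w).
Proof. by have [_ ->] := dexpP; rewrite A_valX. Qed.

Lemma dexp_coefs :
  exists c, [/\ power_series_of c (dexp d), c 0%N = 0 & c 1%N = 1].
Proof.
have [[_ [c ce c1]] _] := dexpP; exists c; split => //.
by rewrite -(power_series_at0 ce) raddf0.
Qed.

End DrinfeldExponential.
End Exponential.

(** * Quasi-periodic functions and the de Rham morphism *)

Section DeRham.
Variables (R : realType) (F : finFieldType) (C : C_infty R F).
Variables (r : nat) (d : drinfeld_module C r).
Implicit Types (c : nat -> C) (f : C -> C) (w : C) (D : Ctau C).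

(** If [f] vanishes at 0 to order [j], dividing the argument by theta^n divides each term by at
    least |theta|^(n j). *)
Lemma power_series_div_theta j c f w n (B : R) : power_series_of c f ->
  (forall i, (i < j)%N -> c i = 0) ->
  (forall i, <|c i|> * <|w|> ^+ i <= B) ->
  <|f (w / theta C ^+ n)|> <= B / (<|theta C|> ^+ n) ^+ j.
Proof.
move=> cf c0 cB.
have t1 : 1 <= <|theta C|> ^+ n by rewrite exprn_ege1 // ltW // vf_abs_theta_gt1.
have t0 : 0 < <|theta C|> ^+ n := lt_le_trans ltr01 t1.
have B0 : 0 <= B by apply: le_trans (cB 0%N); rewrite mulr_ge0 ?exprn_ge0 ?vf_abs_ge0.
apply: power_series_abs_le cf _ _ => [|i].
  by rewrite divr_ge0 // exprn_ge0 // ltW.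
have [/c0 ->|ji] := ltnP i j.
  by rewrite vf_abs0 mul0r divr_ge0 // exprn_ge0 // ltW.
rewrite vf_absM vf_absV vf_absX expr_div_n mulrA ler_pM //.
- by rewrite mulr_ge0 ?exprn_ge0 ?vf_abs_ge0.
- by rewrite invr_ge0 exprn_ge0 // ltW.
- have tX k : 0 < (<|theta C|> ^+ n) ^+ k by exact: exprn_gt0.
  by rewrite lef_pV2 ?posrE // ler_weXn2l.
Qed.

(** Partial sums of the series for F_delta with delta_theta = D. For D = tau^k this is the explicit
    series defining F_k. *)
Definition quasi_sum D w n : C :=
  \sum_(m < n) theta C ^+ m * skew_eval D (dexp d (w / theta C ^+ m.+1)).

(** A double zero at 0 makes f(w / theta^n) of order |theta|^(-2 n), which outweighs the factor
    theta^n. *)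
Lemma power_series_theta_to0 c f w : power_series_of c f ->
  c 0%N = 0 -> c 1%N = 0 ->
  converges_to (fun n => theta C ^+ n * f (w / theta C ^+ n)) 0.
Proof.
move=> cf c0 c1; have /(_ w)[B B0 cB] := power_series_bounded _ cf.
apply: (converges_to0_squeeze (b := fun n => B / <|theta C|> ^+ n)).
  by move=> e e0; apply: div_theta_small => //; exact: ltW.
move=> n; rewrite vf_absM vf_absX.
have tn : 0 < <|theta C|> ^+ n by rewrite exprn_gt0 // vf_abs_gt0 theta_neq0.
rewrite -ler_pdivlMl // [leRHS]mulrC -[leRHS]mulrA -invfM -expr2.
by apply: power_series_div_theta cf _ cB => -[|[]].
Qed.

(* Iterating the functional equation gives
   [f w = quasi_sum D w n + theta^n f (w / theta^n)]. *)
Lemma quasi_periodic_lim D c f w : power_series_of c f ->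
  c 0%N = 0 -> c 1%N = 0 ->
  (forall w, f (theta C * w) - theta C * f w = skew_eval D (dexp d w)) ->
  converges_to (quasi_sum D w) (f w).
Proof.
move=> cf c0 c1 fE; have t0 := theta_neq0 C.
have fS n : f w = quasi_sum D w n + theta C ^+ n * f (w / theta C ^+ n).
  elim: n => [|n IH]; first by rewrite /quasi_sum big_ord0 expr0 divr1 mul1r add0r.
  rewrite {1}IH /quasi_sum big_ord_recr /= -addrA; congr (_ + _).
  have -> : w / theta C ^+ n = theta C * (w / theta C ^+ n.+1).
    by rewrite exprS invfM mulrCA mulVKf.
  by rewrite -fE mulrBr [theta C ^+ n * (theta C * f _)]mulrA -exprSr subrK.
have to0 := power_series_theta_to0 w cf c0 c1.
apply: (converges_to_eq (u := fun n => f w - theta C ^+ n * f (w / theta C ^+ n))).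
  by move=> n; rewrite {1}(fS n) addrK.
rewrite -[X in converges_to _ X]subr0; apply: converges_toB to0.
exact: converges_to_cst.
Qed.

Lemma quasi_sum_Fq_linear D n : Fq_linear (fun w => quasi_sum D w n).
Proof.
apply: Fq_linear_sum => m a x y.
rewrite mulrDl -mulrA (dexp_lin d) Fq_linear_skew_eval mulrDr.
by rewrite mulrCA.
Qed.

Lemma skew_coefs_low D c : skew_coef D 0 = 0 -> c 0%N = 0 ->
  skew_coefs D c 0%N = 0 /\ skew_coefs D c 1%N = 0.
Proof.
move=> D0 c0; split; rewrite /skew_coefs big1 // => -[[|k] kD] _ /=;
  rewrite ?D0 ?mul0r // -[frob_coefs _]/(iter k.+1 _ c).
  by rewrite iter_frob_coefs0 c0 expr0n gtn_eqF ?expn_gt0 ?q_gt0 // mulr0.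
by rewrite iter_frob_coefs1 ?mulr0.
Qed.

(** The coefficients of D(e(w)) are divided by theta^n - theta, which does not enlarge them, so the
    series stays entire. F_q-linearity is inherited from the partial sums [quasi_sum]. *)
Lemma quasi_periodic_exists D : skew_coef D 0 = 0 -> exists f, Fq_entire 0 f /\
  forall w, f (theta C * w) - theta C * f w = skew_eval D (dexp d w).
Proof.
move=> D0; have [c [ce c0 c1]] := dexp_coefs d.
have hP := power_series_skew D ce; set h := skew_coefs D c in hP.
have [h0 h1] : h 0%N = 0 /\ h 1%N = 0 := skew_coefs_low D0 c0.
(* At n = 1 the division by 0 returns 0, the prescribed linear coefficient; this is consistent
   because [h 1] vanishes. *)
pose b n := h n / (theta C ^+ n - theta C).
have bh n : <|b n|> <= <|h n|>.
  have [n1|n1] := leqP n 1.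
    by rewrite /b; case: n n1 => [|[|//]] _; rewrite ?h0 ?h1 mul0r.
  rewrite vf_absM vf_absV ler_piMr ?vf_abs_ge0 // vf_abs_thetaXB //.
  by rewrite invf_le1 ?exprn_gt0 ?exprn_ege1 ?vf_abs_gt0 ?theta_neq0 // ltW // vf_abs_theta_gt1.
have [f bf] : exists f, power_series_of b f.
  apply: power_series_exists => w.
  have /converges_toP hw := power_series_term w hP.
  apply/converges_toP => e /hw[N HN]; exists N => n /HN; rewrite !subr0.
  by apply: le_lt_trans; rewrite (vf_absM (b n)) (vf_absM (h n)) ler_wpM2r ?vf_abs_ge0.
have fE w : f (theta C * w) - theta C * f w = skew_eval D (dexp d w).
  move: w; apply: (@power_series_unique _ _ _ h
    (fun w => f (theta C * w) - theta C * f w) _ _ hP).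
  have := power_seriesB (power_series_scale_arg (theta C) bf)
    (power_seriesZ (theta C) bf).
  suff -> : (fun n => theta C ^+ n * b n - theta C * b n) = h by [].
  apply/funext => n; rewrite -mulrBl /b.
  have [n1|n1] := leqP n 1; last by rewrite mulrC divfK // thetaXB_neq0.
  by case: n n1 => [|[|//]] _; rewrite ?h0 ?h1 mul0r mulr0.
exists f; split=> //; split; last by exists b => //; rewrite /b h1 mul0r.
apply: (Fq_linear_lim (u := fun n w => quasi_sum D w n)).
  exact: quasi_sum_Fq_linear.
by move=> w; apply: quasi_periodic_lim bf _ _ fE; rewrite /b ?h0 ?h1 mul0r.
Qed.

Lemma bider_coef0 (delta : biderivation d) a : skew_coef (delta a) 0 = 0.
Proof. by have /asboolP[_ ->] := biderP delta. Qed.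

Lemma F_deltaP (delta : biderivation d) : is_quasi_periodic delta (F_delta delta).
Proof.
apply: (@xgetPex _ _ [set f | is_quasi_periodic delta f]).
exact/quasi_periodic_exists/bider_coef0.
Qed.

Lemma F_delta_lim (delta : biderivation d) w :
  converges_to (quasi_sum (delta 'X) w) (F_delta delta w).
Proof.
have [[flin [c cf c1]] fE] := F_deltaP delta.
apply: (quasi_periodic_lim _ cf _ c1 fE).
by rewrite -(power_series_at0 cf); have := Fq_linearB flin 0 0; rewrite !subrr.
Qed.

(** [F_delta] is obtained by choice, so linearity in delta is read off the sums [quasi_sum], whose
    limit is unique. *)
Lemma dR_period_is_linear : linear (@dR_period R F C r d).
Proof.
move=> a x y; apply: val_inj; apply/funext => w /=.
rewrite -[RHS]/(a * F_delta x (lam w) + F_delta y (lam w)).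
apply: converges_to_unique (F_delta_lim _ _) _.
apply: converges_to_eq
  (converges_toD (converges_toZ a (F_delta_lim x _)) (F_delta_lim y _)) => n.
have -> : bider_fun (a *: x + y) 'X = a *: x 'X + y 'X by [].
rewrite /quasi_sum mulr_sumr -big_split; apply: eq_bigr => m _ /=.
by rewrite skew_evalDl skew_evalZl mulrDr mulrCA.
Qed.

(** The sum telescopes because d_theta(e(w / theta^(m + 1))) = e(w / theta^m). *)
Lemma inner_quasi_sum (n : Ctau C) w N :
  quasi_sum (n * d 'X - theta C *: n) w N =
  skew_eval n (dexp d w) - theta C ^+ N * skew_eval n (dexp d (w / theta C ^+ N)).
Proof.
have t0 := theta_neq0 C.
elim: N => [|N IH].
  by rewrite /quasi_sum big_ord0 expr0 divr1 mul1r subrr.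
rewrite /quasi_sum big_ord_recr /= -/(quasi_sum _ _ _) IH.
rewrite skew_evalDl skew_evalM -dexp_theta skew_evalNl skew_evalZl.
have <- : w / theta C ^+ N = theta C * (w / theta C ^+ N.+1).
  by rewrite exprS invfM mulrCA mulVKf.
by rewrite mulrBr addrA subrK mulrA -exprSr.
Qed.

(** On a period the first term of the telescoped sum vanishes. The other tends to 0, as n(e(w)) has
    a double zero at 0. *)
Lemma dR_period_inner (delta : biderivation d) :
  strictly_inner delta -> dR_period delta = 0.
Proof.
move=> [n [n0 dE]]; apply: val_inj; apply/funext => w /=.
rewrite -[RHS]/0; apply: converges_to_unique (F_delta_lim _ _) _.
have [c [ce c0 c1]] := dexp_coefs d.
have [h0 h1] := skew_coefs_low n0 c0.
have := power_series_theta_to0 (lam w) (power_series_skew n ce) h0 h1.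
move=> /(converges_toB (converges_to_cst 0)); rewrite subr0.
apply: converges_to_eq => N; rewrite dE A_valX inner_quasi_sum.
by rewrite (eqP (lamP w)) raddf0.
Qed.

Lemma dR_period_class (x y : biderivation d) :
  dR_class x = dR_class y -> dR_period x = dR_period y.
Proof.
move=> /dR_class_eq/dR_period_inner xy; have := dR_period_is_linear (-1) y x.
rewrite !scaleN1r [- y + x]addrC xy addrC => /esym/eqP.
by rewrite subr_eq0 => /eqP.
Qed.

Definition dR_map (x : H1DR d) : HomA d := dR_period (repr x).

Lemma dR_map_class (delta : biderivation d) :
  dR_map (dR_class delta) = dR_period delta.
Proof. by apply: dR_period_class; rewrite /dR_class reprK. Qed.

Lemma dR_map_is_linear : linear dR_map.
Proof.
move=> a x y; have [x' ->] := dR_class_surj x; have [y' ->] := dR_class_surj y.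
have -> : a *: dR_class x' + dR_class y' = dR_class (a *: x' + y').
  by rewrite dR_classD -dR_classZ.
by rewrite !dR_map_class dR_period_is_linear.
Qed.

HB.instance Definition _ :=
  GRing.isLinear.Build C (H1DR d) (HomA d) *:%R dR_map dR_map_is_linear.

End DeRham.

(** * Biderivations modulo strictly inner ones *)

Section Biderivations.
Variables (R : realType) (F : finFieldType) (C : C_infty R F).
Variables (r : nat) (d : drinfeld_module C r).
Implicit Types (D n : Ctau C) (a b : {poly F}).

Lemma A_valC (c : F) : A_val C c%:P = vf_const C c.
Proof. by rewrite /A_val map_polyC hornerC. Qed.

Lemma A_val0 : A_val C 0 = 0.
Proof. by rewrite -polyC0 A_valC rmorph0. Qed.

Lemma skew_coefB D n i : skew_coef (D - n) i = skew_coef D i - skew_coef n i.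
Proof. exact: coefB. Qed.

Lemma skew_monomial_coefM (c : C) i D m :
  skew_coef (skew_monomial (@frobq R F C) c i * D) m =
  if (i <= m)%N then c * iter i (@frobq R F C) (skew_coef D (m - i)) else 0.
Proof.
case: leqP => [im|mi]; first by rewrite -{1}(subnKC im) skew_monomial_mulE.
rewrite [D]skewpoly_expand mulr_sumr skew_coef_sum big1 // => j _.
by rewrite skew_monomialM skew_monomialE ltn_eqF // (leq_trans mi) ?leq_addr.
Qed.

Lemma skew_coef0M D n : skew_coef D 0 = 0 -> skew_coef (D * n) 0 = 0.
Proof.
move=> D0; rewrite [D]skewpoly_expand mulr_suml skew_coef_sum big1 // => i _.
by rewrite skew_monomial_coefM leqn0; case: eqP => // ->; rewrite D0 mul0r.
Qed.

Lemma skew_mul_const D (c : F) : D * (vf_const C c)%:A = vf_const C c *: D.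
Proof.
have -> : (vf_const C c)%:A = skew_monomial (@frobq R F C) (vf_const C c) 0.
  by apply: val_inj; rewrite /= expr0.
rewrite [D]skewpoly_expand mulr_suml scaler_sumr; apply: eq_bigr => i _.
rewrite skew_monomialM iter_frobq_const addn0 mulrC.
by apply: val_inj; rewrite /= scalerA.
Qed.

Lemma skew_mulZ_const D n (c : F) : D * (vf_const C c *: n) = vf_const C c *: (D * n).
Proof. by rewrite -[n in LHS]mul1r scalerAl mulrA skew_mul_const scalerAl. Qed.

(* The value at ['X ^ i] of the biderivation sending ['X] to [D]. *)
Fixpoint bider_pow D (i : nat) : Ctau C :=
  if i is i'.+1 then theta C *: bider_pow D i' + D * d 'X^i' else 0.

Definition bider_of D a : Ctau C :=
  \sum_(i < size a) vf_const C a`_i *: bider_pow D i.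

Lemma bider_of_widen m D a : (size a <= m)%N ->
  bider_of D a = \sum_(i < m) vf_const C a`_i *: bider_pow D i.
Proof.
move=> am; rewrite /bider_of (big_ord_widen m
  (fun i => vf_const C a`_i *: bider_pow D i)) // big_mkcond /=.
apply: eq_bigr => i _; case: ltnP => // ai.
by rewrite nth_default // rmorph0 scale0r.
Qed.

Lemma bider_of_Fq_linear D (c : F) a b :
  bider_of D (c *: a + b) = vf_const C c *: bider_of D a + bider_of D b.
Proof.
pose m := maxn (size a) (size b).
rewrite !(@bider_of_widen m) ?leq_maxl ?leq_maxr //; last first.
  rewrite (leq_trans (size_polyD _ _)) // geq_max leq_maxr andbT.
  by rewrite (leq_trans (size_scale_leq _ _)) ?leq_maxl.
rewrite scaler_sumr -big_split; apply: eq_bigr => i _ /=.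
by rewrite coefD coefZ rmorphD rmorphM scalerDl scalerA.
Qed.

Lemma bider_ofC D (c : F) : bider_of D c%:P = 0.
Proof. by rewrite (@bider_of_widen 1) ?size_polyC_leq1 // big_ord1 scaler0. Qed.

Lemma bider_ofMX D a : bider_of D (a * 'X) = theta C *: bider_of D a + D * d a.
Proof.
have sX : (size (a * 'X)%R <= (size a).+1)%N.
  by rewrite (leq_trans (size_polyMleq _ _)) // size_polyX addn2.
rewrite (bider_of_widen D sX) big_ord_recl scaler0 add0r.
rewrite -[a in d a]coefK poly_def rmorph_sum mulr_sumr scaler_sumr -big_split.
apply: eq_bigr => i _ /=; rewrite coefMX /= scalerDr !scalerA [theta C * _]mulrC.
congr (_ + _); rewrite -mul_polyC rmorphM /= dm_const -scalerAl mul1r.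
by rewrite skew_mulZ_const.
Qed.

(** The product rule is proved by induction on the left factor: commutativity of A moves its ['X] to
    the right end, where [bider_ofMX] removes it. *)
Lemma bider_of_is_biderivation D : skew_coef D 0 = 0 ->
  is_biderivation d (bider_of D).
Proof.
move=> D0; split; first exact: bider_of_Fq_linear.
  move=> a; rewrite skew_coef_sum big1 // => i _; rewrite skew_coefZ.
  suff -> : skew_coef (bider_pow D i) 0 = 0 by rewrite mulr0.
  elim: (i : nat) => [|k IH] /=; first exact: skew_coef0.
  by rewrite skew_coefD skew_coefZ IH mulr0 add0r skew_coef0M.
have bD a b : bider_of D (a + b) = bider_of D a + bider_of D b.
  by have := bider_of_Fq_linear D 1 a b; rewrite !scale1r rmorph1 scale1r.
have bZ (c : F) a : bider_of D (c%:P * a) = vf_const C c *: bider_of D a.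
  rewrite mul_polyC; have := bider_of_Fq_linear D c a 0.
  by rewrite addr0 -[0 in X in _ + X]polyC0 bider_ofC addr0.
elim/poly_ind => [|a c IH] b.
  by rewrite mul0r A_val0 scale0r -polyC0 bider_ofC mul0r addr0.
rewrite mulrDl !bD bZ bider_ofC addr0 -mulrA [_ * b]mulrC mulrA !bider_ofMX IH.
rewrite A_valD A_valM A_valX A_valC rmorphM /=.
rewrite scalerDl scalerDr scalerA mulrDl -scalerAl mulrA [theta C * _]mulrC.
by rewrite -!addrA; congr (_ + _); rewrite addrA addrC.
Qed.

Lemma biderivation_exists D : skew_coef D 0 = 0 ->
  exists delta : biderivation d, delta 'X = D.
Proof.
move=> D0; have bP : biderivationb d (bider_of D).
  by apply/asboolP; exact: bider_of_is_biderivation.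
exists (Biderivation bP); rewrite /= -[X in bider_of D X]mul1r bider_ofMX.
by rewrite -polyC1 bider_ofC scaler0 add0r rmorph1 mulr1.
Qed.

(** Both sides obey the same product rule and vanish on constants, so agreement at ['X] extends to
    all of A. *)
Lemma strictly_innerP (delta : biderivation d) n : skew_coef n 0 = 0 ->
  delta 'X = n * d 'X - theta C *: n -> strictly_inner delta.
Proof.
move=> n0 dX; have /asboolP[dlin _ dM] := biderP delta.
have d0 : delta 0 = 0.
  by have := dlin (-1) 0 0; rewrite scaler0 addr0 rmorphN rmorph1 scaleN1r addNr.
have d1 : delta 1 = 0.
  have /eqP := dM 1 1; rewrite mulr1 A_val1 scale1r rmorph1 mulr1.
  by rewrite -subr_eq0 opprD addNKr oppr_eq0 => /eqP.
have dC (c : F) : delta c%:P = 0.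
  by have := dlin c 1 0; rewrite addr0 d1 d0 scaler0 addr0 alg_polyC.
exists n; split=> //; elim/poly_ind => [|a c IH].
  by rewrite d0 rmorph0 mulr0 A_val0 scale0r subrr.
have := dlin 1 (a * 'X) c%:P; rewrite rmorph1 !scale1r dC addr0 => ->.
rewrite dM dX IH rmorphD rmorphM /= dm_const A_valD A_valM A_valX.
rewrite A_valC mulrDr skew_mul_const scalerDl.
rewrite opprD addrACA subrr addr0 mulrBl scalerBr scalerA -scalerAl mulrA.
by rewrite [LHS]addrC subrKA.
Qed.

Lemma skew_size_leP D m :
  (forall k, (m <= k)%N -> skew_coef D k = 0) -> (skew_size D <= m)%N.
Proof. by move=> Dm; apply/leq_sizeP. Qed.

(** Division by d_theta: a leading term of degree t > r is cancelled by n = (D_t / Delta^(q^i))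
    tau^i with i = t - r. Since i > 0, n has no constant term. *)
Lemma reduce_modulo_inner D : (0 < r)%N -> skew_coef D 0 = 0 -> exists n,
  skew_coef n 0 = 0 /\ (skew_size (D - (n * d 'X - theta C *: n))%R <= r.+1)%N.
Proof.
move=> r0; have [m] := ubnP (skew_size D); elim: m D => // m IH D; rewrite ltnS.
move=> Dm D0; have [Dr|rD] := leqP (skew_size D) r.+1.
  by exists 0; rewrite skew_coef0 mul0r scaler0 subrr subr0.
pose t := (skew_size D).-1; have tE : skew_size D = t.+1 by rewrite prednK // (ltn_trans _ rD).
have rt : (r < t)%N by rewrite -ltnS -tE.
pose Delta := skew_coef (d 'X) r.
have Delta0 : Delta != 0.
  have : lead_coef (skew_val (d 'X)) != 0.
    by rewrite lead_coef_eq0 -size_poly_eq0 -/(skew_size _) dm_rank.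
  by rewrite lead_coefE -/(skew_size _) dm_rank.
pose i := (t - r)%N; have i0 : (0 < i)%N by rewrite subn_gt0.
have it : (i + r = t)%N by rewrite subnK // ltnW.
pose n := skew_monomial (@frobq R F C) (skew_coef D t / iter i (@frobq R F C) Delta) i.
have n0 : skew_coef n 0 = 0 by rewrite skew_monomialE ltn_eqF.
have [|//|n' [n'0 n'D]] := IH (D - (n * d 'X - theta C *: n)).
- rewrite (leq_trans _ Dm) // tE ltnS; apply: skew_size_leP => k tk.
  rewrite !skew_coefB skew_coefZ.
  rewrite skew_monomial_coefM skew_monomialE (leq_trans _ tk) ?leq_subr //.
  (* As r > 0, the degree i of theta n is below t, so theta n does not affect the degrees from t
     on. *)
  have ki : (k == i) = false by rewrite gtn_eqF // (leq_trans _ tk) // -it -addn1 leq_add2l.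
  rewrite ki mulr0 subr0.
  move: tk; rewrite leq_eqVlt => /predU1P[<-|tk].
    by rewrite -[in (t - i)%N]it addKn divfK ?subrr // iter_frobq expf_neq0.
  have -> : skew_coef D k = 0 by rewrite skew_coef_default // tE.
  rewrite [skew_coef (d 'X) _]skew_coef_default ?dm_rank ?(iter_sigma0 (@frobq R F C)) ?mulr0 ?subrr //.
  by rewrite ltn_subRL it.
- rewrite !skew_coefB skew_coefZ.
  by rewrite D0 n0 skew_coef0M // mulr0 !subr0.
exists (n + n'); rewrite skew_coefD n0 n'0 addr0; split=> //.
suff -> : (n + n') * d 'X - theta C *: (n + n') =
    (n * d 'X - theta C *: n) + (n' * d 'X - theta C *: n') by rewrite opprD addrA.
by rewrite [RHS]addrACA -opprD mulrDl scalerDr.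
Qed.

Lemma reduced_representative (delta : biderivation d) : (0 < r)%N ->
  exists delta' : biderivation d,
    dR_class delta = dR_class delta' /\ (skew_size (delta' 'X) <= r.+1)%N.
Proof.
move=> r0; have d0 := bider_coef0 delta 'X.
have [n [n0 nD]] := reduce_modulo_inner r0 d0.
set D := _ - _ in nD; have [|delta' dE] := @biderivation_exists D.
  rewrite /D !skew_coefB skew_coefZ.
  by rewrite d0 n0 skew_coef0M // mulr0 !subr0.
exists delta'; split; last by rewrite dE.
apply/dR_class_eq/(strictly_innerP n0).
have -> : bider_fun (delta - delta') 'X = delta 'X - delta' 'X by [].
by rewrite dE /D opprB addrC subrK.
Qed.

End Biderivations.

(** * Surjectivity of the exponential *)

Section DexpSurjective.
Variables (R : realType) (F : finFieldType) (C : C_infty R F).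
Variables (r : nat) (d : drinfeld_module C r).
Variable c : nat -> C.
Hypothesis ce : power_series_of c (dexp d).
Hypotheses (c0 : c 0%N = 0) (c1 : c 1%N = 1).
Implicit Types (w z : C).
Local Notation e := (dexp d).

(** Stronger than |e(w)| <= B: all terms of the series are bounded. Unlike the bound on the sum,
    this depends only on |w| and improves when w is divided by theta. *)
Definition dominated w (B : R) : Prop := forall i, <|c i|> * <|w|> ^+ i <= B.

Lemma dominated0 B : 0 <= B -> dominated 0 B.
Proof.
move=> B0 [|i]; first by rewrite c0 vf_abs0 mul0r.
by rewrite vf_abs0 expr0n mulr0.
Qed.

Lemma dominated_le w w' B : <|w|> <= <|w'|> -> dominated w' B -> dominated w B.
Proof.
move=> ww' wB i; apply: le_trans (wB i).
by rewrite ler_wpM2l ?vf_abs_ge0 // lerXn2r // nnegrE vf_abs_ge0.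
Qed.

Lemma dominated_abs_le w B : dominated w B -> <|w|> <= B.
Proof. by move=> /(_ 1%N); rewrite c1 vf_abs1 mul1r. Qed.

Lemma dominatedD w w' B : dominated w B -> dominated w' B -> dominated (w + w') B.
Proof.
move=> wB w'B; have := vf_abs_ultra w w'; rewrite le_max.
by case/orP => le; [exact: dominated_le wB | exact: dominated_le w'B].
Qed.

Lemma dominated_lim (u : nat -> C) w B : (forall n, dominated (u n) B) ->
  converges_to u w -> dominated w B.
Proof.
move=> uB uw; have [->|w0] := eqVneq w 0.
  by apply: dominated0; apply: le_trans (dominated_abs_le (uB 0%N)); exact: vf_abs_ge0.
have [N uN] := converges_to_gt0_abs w0 uw.
by apply: dominated_le (uB N); rewrite uN.
Qed.

Lemma dexp_dominated w B n : dominated w B ->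
  <|e (w / theta C ^+ n)|> <= B / <|theta C|> ^+ n.
Proof.
move=> wB; rewrite -[_ ^+ n in leRHS]expr1.
by apply: power_series_div_theta ce _ wB; case.
Qed.

(* A root of smallest absolute value of a truncation of [e - z] has the
   required size by the Newton polygon. *)
Lemma dexp_approx z : exists w, dominated w <|z|> /\ <|z - e w|> <= <|z|> / 2.
Proof.
have [->|z0] := eqVneq z 0.
  by exists 0; rewrite vf_abs0 raddf0 subrr vf_abs0 mul0r; split => //; exact: dominated0.
have zp : 0 < <|z|> by rewrite vf_abs_gt0.
have /converges_toP/(_ _ (divr_gt0 zp (ltr0n R 2)))[N HN] := power_series_term z ce.
(* The truncation keeps the linear term, whose coefficient 1 gives |w| <= |z|. The terms of e(w)
   from index N on are then at most |z| / 2. *)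
pose M := maxn N 2; pose p := \poly_(i < M) c i - z%:P.
have M2 : (1 < M)%N by rewrite leq_maxr.
have pE i : (0 < i < M)%N -> p`_i = c i.
  move=> /andP[i0 iM]; rewrite coefB coefC coef_poly iM gtn_eqF //.
  by rewrite subr0.
have p1 : p`_1 = 1 by rewrite pE.
have sp : (1 < size p)%N.
  by rewrite ltnNge; apply/negP => /leq_sizeP/(_ 1%N isT)/eqP; rewrite p1 oner_eq0.
have [w /eqP pw wmin] := exists_min_root sp.
have p0 : <|p`_0|> = <|z|>.
  by rewrite coefB coefC coef_poly eqxx c0 if_same sub0r vf_absN.
have wz : <|w|> <= <|z|> by have := wmin 1%N; rewrite p1 vf_abs1 mul1r p0.
have tail i : (M <= i)%N -> <|c i|> * <|w|> ^+ i <= <|z|> / 2.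
  rewrite geq_max => /andP[/HN]; rewrite subr0 vf_absM vf_absX => /ltW le _.
  by apply: le_trans le; rewrite ler_wpM2l ?vf_abs_ge0 // lerXn2r // nnegrE vf_abs_ge0.
exists w; split=> [i|].
  have [Mi|iM] := leqP M i; first by rewrite (le_trans (tail i Mi)) //; lra.
  have [->|i0] := posnP i; first by rewrite c0 vf_abs0 mul0r ltW.
  by rewrite -pE ?i0 // -p0.
rewrite vf_abs_sub; have zE : z = \sum_(i < M) c i * w ^+ i.
  by move: pw; rewrite /p hornerD hornerN hornerC horner_poly => /subr0_eq.
rewrite {1}zE; apply: power_series_tail_le ce _ _.
  by rewrite divr_ge0 // vf_abs_ge0.
exact: tail.
Qed.

Lemma dexp_small : exists2 B : R, 1 <= B &
  forall u, <|u|> <= 1 -> <|e u|> <= B * <|u|> /\ <|e u - u|> <= B * <|u|> ^+ 2.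
Proof.
have /(_ 1)[B B0 cB] := power_series_bounded _ ce.
have {}cB i : <|c i|> <= B by have := cB i; rewrite vf_abs1 expr1n mulr1.
have uX (u : C) m n : <|u|> <= 1 -> (m <= n)%N -> <|c n|> * <|u|> ^+ n <= B * <|u|> ^+ m.
  by move=> u1 mn; rewrite ler_pM ?exprn_ge0 ?vf_abs_ge0 // ler_wiXn2l ?vf_abs_ge0.
exists B => [|u u1]; first by have := cB 1%N; rewrite c1 vf_abs1.
have Bu m : 0 <= B * <|u|> ^+ m by rewrite mulr_ge0 ?exprn_ge0 ?vf_abs_ge0 // ltW.
split.
  rewrite -[<|u|> in leRHS]expr1; apply: power_series_abs_le ce (Bu _) _ => -[|n].
    by rewrite c0 vf_abs0 mul0r.
  exact: uX.
have -> : e u - u = e u - \sum_(i < 2) c i * u ^+ i.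
  by rewrite !big_ord_recr big_ord0 /= c0 c1 mul0r !add0r mul1r expr1.
by apply: power_series_tail_le ce (Bu _) _ => n; exact: uX.
Qed.

(** For a period u the estimate |e(u) - u| <= B |u|^2 reads |u| <= B |u|^2, so u = 0 or |u| >= 1 /
    B. *)
Lemma no_small_period : exists2 eps : R, 0 < eps &
  forall u, e u = 0 -> <|u|> < eps -> u = 0.
Proof.
have [B B1 eB] := dexp_small; have B0 := lt_le_trans ltr01 B1.
exists B^-1 => [|u eu ub]; first by rewrite invr_gt0.
have u1 : <|u|> <= 1 by rewrite ltW // (lt_le_trans ub) // invf_le1.
have [_] := eB u u1; rewrite eu sub0r vf_absN.
apply: contraTeq; rewrite -vf_abs_gt0 -ltNge => u0.
rewrite expr2 mulrA -[X in _ < X]mul1r ltr_pM2r //.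
by rewrite mulrC -ltr_pdivlMr // div1r.
Qed.

Lemma dexp_continuous (u : nat -> C) w :
  converges_to u w -> converges_to (fun n => e (u n)) (e w).
Proof.
have [B B1 eB] := dexp_small; have B0 := lt_le_trans ltr01 B1.
move=> /converges_toP uw; apply/converges_toP => s s0.
have m0 : 0 < Num.min 1 (s / B) by rewrite lt_min ltr01 divr_gt0.
have [N HN] := uw _ m0; exists N => n /HN; rewrite lt_min => /andP[lt1 lts].
rewrite -raddfB; have [le _] := eB _ (ltW lt1); apply: le_lt_trans le _.
by rewrite mulrC -ltr_pdivlMr.
Qed.

(** Successive approximation: [Z n] is the error after n corrections and [W n] their sum. Each
    correction halves the bound on the error and is dominated by |z|, a property stable under sums
    and limits. *)
Lemma dexp_surjective z : exists w, e w = z /\ dominated w <|z|>.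
Proof.
have /choice[s sP] := dexp_approx.
pose Z n := iter n (fun x => x - e (s x)) z.
pose W n := \sum_(i < n) s (Z i).
have Zle n : <|Z n|> <= <|z|> * (1 / 2) ^+ n.
  elim: n => [|n IH]; first by rewrite expr0 mulr1.
  have [_ le] := sP (Z n); apply: le_trans le _; rewrite exprSr.
  by move: IH; set p := _ ^+ n => IH; lra.
have half : 0 <= (1 / 2 : R) < 1 by apply/andP; split; lra.
have Z0 : converges_to Z 0.
  apply: (converges_to0_squeeze (b := fun n => <|z|> * (1 / 2) ^+ n)) => // ep ep0.
  have ep0' : 0 < ep / (<|z|> + 1) by rewrite divr_gt0 // ltr_pwDr // vf_abs_ge0.
  have [N HN] := expr_lt_eventually half ep0'; exists N => n /HN.
  rewrite ltr_pdivlMr ?ltr_pwDr ?vf_abs_ge0 //; apply: le_lt_trans.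
  rewrite mulrC ler_wpM2l ?lerDl // exprn_ge0 //; lra.
have Zz n : <|Z n|> <= <|z|>.
  apply: le_trans (Zle n) _; rewrite ler_piMr ?vf_abs_ge0 // exprn_ile1 //; lra.
have Wdom n : dominated (W n) <|z|>.
  elim: n => [|n IH]; first by rewrite /W big_ord0; apply/dominated0/vf_abs_ge0.
  rewrite /W big_ord_recr /=; apply: dominatedD => // i.
  by have [dom _] := sP (Z n); exact: le_trans (dom i) (Zz n).
have eW n : e (W n) = z - Z n.
  elim: n => [|n IH]; first by rewrite /W big_ord0 raddf0 subrr.
  by rewrite /W big_ord_recr raddfD /= -/(W n) IH opprB -addrA [- _ + _]addrC.
have [w Ww] : exists w, converges_to W w.
  apply: ci_complete => ep ep0.
  have /converges_toP/(_ ep ep0)[N HN] := Z0; exists N => m n Nm Nn.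
  apply: (vf_abs_sub_consec (u := W)) Nm Nn => // k /HN.
  rewrite subr0 /W big_ord_recr /= addrAC subrr add0r; apply: le_lt_trans.
  by have [/dominated_abs_le] := sP (Z k).
exists w; split; last exact: dominated_lim Wdom Ww.
apply: converges_to_unique (dexp_continuous Ww) _.
rewrite -[X in converges_to _ X]subr0.
apply: converges_to_eq (converges_toB (converges_to_cst z) Z0) => n.
by rewrite eW.
Qed.

(** For a dominant term of index k of e(u), |c_k| |w|^k <= B <= |e(u)| <= |c_k| |u|^k. Here k > 0
    because c_0 = 0, so k-th roots can be compared. *)
Lemma dominated_abs_ge w u B : e u != 0 -> dominated w B -> B <= <|e u|> ->
  <|w|> <= <|u|>.
Proof.
move=> eu0 wB Bu; have [k uk] := power_series_dominant ce eu0.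
have := le_trans (wB k) (le_trans Bu uk).
have eup : 0 < <|e u|> by rewrite vf_abs_gt0.
have ck : 0 < <|c k|>.
  rewrite vf_abs_gt0; apply: contraTneq (lt_le_trans eup uk) => ->.
  by rewrite vf_abs0 mul0r ltxx.
have k0 : (0 < k)%N by rewrite lt0n; apply: contraTneq ck => ->; rewrite c0 vf_abs0 ltxx.
by rewrite ler_pM2l // ler_pXn2r ?nnegrE ?vf_abs_ge0.
Qed.

End DexpSurjective.

(** * Orthogonal families and additive polynomials *)

Section OrthogonalFamilies.
Variables (R : realType) (F : finFieldType) (C : C_infty R F).
Implicit Types (v x : nat -> C) (a : nat -> F) (L : seq C).
Local Notation q := #|F|.

Definition lincomb n v a : C := \sum_(j < n) vf_const C (a j) * v j.

Definition Fq_free n v : Prop :=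
  forall a, lincomb n v a = 0 -> forall i, (i < n)%N -> a i = 0.

(** Nonzero constants have absolute value 1, so orthogonality says that a combination has the
    largest |v_i| with a_i nonzero as its absolute value. Only the nontrivial inequality is
    recorded. *)
Definition Fq_orthogonal n v : Prop :=
  forall a i, (i < n)%N -> a i != 0 -> <|v i|> <= <|lincomb n v a|>.

Definition Fq_stable L : Prop := {in L &, forall y z, forall b : F,
  vf_const C b * y + z \in L}.

Let extend n (f : {ffun 'I_n -> F}) (j : nat) : F :=
  if insub j is Some i then f i else 0.

Let extendE n (f : {ffun 'I_n -> F}) (i : 'I_n) : extend f i = f i.
Proof. by rewrite /extend valK. Qed.

Definition lincombs n v : seq C :=
  [seq lincomb n v (extend f) | f <- enum {ffun 'I_n -> F}].

Lemma size_lincombs n v : size (lincombs n v) = (q ^ n)%N.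
Proof. by rewrite size_map -cardE card_ffun card_ord. Qed.

Lemma lincomb_mem n v a : lincomb n v a \in lincombs n v.
Proof.
apply/mapP; exists [ffun i : 'I_n => a i]; first by rewrite mem_enum.
by apply: eq_bigr => i _; rewrite extendE ffunE.
Qed.

Lemma lincombsP n v y : y \in lincombs n v -> exists a, y = lincomb n v a.
Proof. by move=> /mapP[f _ ->]; exists (extend f). Qed.

Lemma lincombD n v a a' (b : F) :
  lincomb n v (fun i => b * a i + a' i) = vf_const C b * lincomb n v a + lincomb n v a'.
Proof.
rewrite mulr_sumr -big_split; apply: eq_bigr => i _ /=.
by rewrite rmorphD rmorphM mulrDl mulrA.
Qed.

Lemma lincomb_stable L n v a : 0 \in L -> Fq_stable L ->
  (forall i, (i < n)%N -> v i \in L) -> lincomb n v a \in L.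
Proof.
move=> L0 Lst; elim: n => [|n IH] vL; first by rewrite /lincomb big_ord0.
rewrite /lincomb big_ord_recr /= addrC; apply: Lst; first exact: vL.
by apply: IH => i lin; apply: vL; exact: ltnW.
Qed.

Lemma Fq_free_card n v L : Fq_free n v ->
  (forall a, lincomb n v a \in L) -> (q ^ n <= size L)%N.
Proof.
move=> vfree vL; rewrite -(size_lincombs n v); apply: uniq_leq_size.
  rewrite map_inj_uniq ?enum_uniq // => f g fg; apply/ffunP => i.
  have /vfree/(_ i (ltn_ord i))/eqP : lincomb n v (fun j => -1 * extend g j + extend f j) = 0.
    by rewrite lincombD fg rmorphN rmorph1 mulN1r addNr.
  by rewrite !extendE mulN1r addrC subr_eq0 => /eqP.
by move=> y /lincombsP[a ->].
Qed.

Lemma Fq_orthogonal_free n v :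
  (forall i, (i < n)%N -> v i != 0) -> Fq_orthogonal n v -> Fq_free n v.
Proof.
move=> v0 vorth a a0 i lin; apply/eqP/negPn/negP => ai.
have := vorth a i lin ai; rewrite a0 vf_abs0 leNgt vf_abs_gt0.
by rewrite v0.
Qed.

(* [y] is chosen of least absolute value outside of the span. *)
Lemma Fq_orthogonal_extend L n v : 0 \in L -> Fq_stable L ->
  (forall i, (i < n)%N -> v i \in L) -> Fq_orthogonal n v ->
  (exists2 y, y \in L & y \notin lincombs n v) ->
  exists y, [/\ y \in L, y != 0 &
    Fq_orthogonal n.+1 (fun i => if (i < n)%N then v i else y)].
Proof.
move=> L0 Lst vL vorth [y yL yn].
have [|x] := exists_min_seq (fun z : C => <|z|>)
    (s := [seq z <- L | z \notin lincombs n v]).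
  apply/negP => /eqP fn.
  have : y \in [seq z <- L | z \notin lincombs n v] by rewrite mem_filter yn.
  by rewrite fn.
rewrite mem_filter => /andP[xn xL] xmin; exists x; split => //.
  apply: contra xn => /eqP ->; have -> : 0 = lincomb n v (fun=> 0).
    by rewrite /lincomb big1 // => i _; rewrite rmorph0 mul0r.
  exact: lincomb_mem.
pose v' i := if (i < n)%N then v i else x.
change (Fq_orthogonal n.+1 v') => a i; rewrite ltnS => lin ai.
have vE b : lincomb n.+1 v' b = lincomb n v b + vf_const C (b n) * x.
  rewrite /lincomb big_ord_recr /= {2}/v' ltnn; congr (_ + _).
  by apply: eq_bigr => j _; rewrite /v' ltn_ord.
rewrite vE; set u := lincomb n v a.
have [an|an] := eqVneq (a n) 0.
  have {}lin : (i < n)%N.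
    by rewrite ltn_neqAle lin andbT; apply: contraNneq ai => ->; rewrite an.
  by rewrite an rmorph0 mul0r addr0 /v' lin vorth.
(* As [a n] is nonzero, z lies outside the span, and |x| <= |z| by minimality. Then u = z - a_n x
   also has absolute value at most |z|. *)
set z := u + _; have xz : <|x|> <= <|z|>.
  apply: xmin; rewrite mem_filter; apply/andP; split; last first.
    by rewrite /z addrC; exact: (Lst x u xL (lincomb_stable a L0 Lst vL)).
  apply: contra xn => /lincombsP[b zE].
  have -> : x = lincomb n v (fun i => (a n)^-1 * (-1 * a i + b i) + 0).
    rewrite (lincombD _ _ (fun i => -1 * a i + b i) (fun=> 0)) lincombD -zE -/u.
    rewrite [X in _ + X]/lincomb big1 ?addr0; last by move=> j _; rewrite rmorph0 mul0r.
    by rewrite rmorphN rmorph1 mulN1r addKr mulrA -rmorphM mulVf // rmorph1 mul1r.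
  exact: lincomb_mem.
rewrite /v'; case: ltnP => // lin'; apply: (le_trans (vorth a i lin' ai)).
have -> : lincomb n v a = z - vf_const C (a n) * x by rewrite addrK.
by apply: vf_absB_le => //; rewrite vf_absM vf_abs_const // mul1r.
Qed.

(** Counting drives the construction: fewer than n vectors cannot span L, and an element outside the
    span of n of them would yield q^(n + 1) elements of L. *)
Lemma Fq_orthogonal_basis L n : uniq L -> 0 \in L -> Fq_stable L ->
  size L = (q ^ n)%N ->
  exists v, [/\ forall i, (i < n)%N -> v i \in L,
    forall i, (i < n)%N -> v i != 0, Fq_orthogonal n v &
    forall y, y \in L -> exists a, y = lincomb n v a].
Proof.
move=> Luniq L0 Lst sL.
have ext m : (m <= n)%N -> exists v, [/\ forall i, (i < m)%N -> v i \in L,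
    forall i, (i < m)%N -> v i != 0 & Fq_orthogonal m v].
  elim: m => [|m IH] mn; first by exists (fun=> 0); split.
  have [v [vL v0 vorth]] := IH (ltnW mn).
  have [|y [yL y0 yorth]] := Fq_orthogonal_extend L0 Lst vL vorth.
    apply: contrapT => no; have : (size L <= size (lincombs m v))%N.
      apply: uniq_leq_size => // y yL; apply: contrapT => yn.
      by apply: no; exists y => //; exact/negP.
    by rewrite sL size_lincombs leq_exp2l ?q_gt1 // leqNgt mn.
  by exists (fun i => if (i < m)%N then v i else y); split=> // i _;
    case: ifP => lim; rewrite ?vL ?v0.
have [v [vL v0 vorth]] := ext n (leqnn n); exists v; split => // y yL.
apply: lincombsP; apply: contrapT => /negP yn.
have [|z [zL z0 zorth]] := Fq_orthogonal_extend L0 Lst vL vorth.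
  by exists y.
have := @Fq_free_card n.+1 (fun i => if (i < n)%N then v i else z) L.
rewrite sL leq_exp2l ?q_gt1 // ltnn => absurd; suff : False by [].
suff : false by []; apply: absurd.
  by apply: Fq_orthogonal_free zorth => i _; case: ifP => // /v0.
by move=> a; apply: lincomb_stable => // i _; case: ifP => // /vL.
Qed.

(** A nontrivial relation among the x_j would give sum a_j v_j = sum a_j (v_j - x_j), and by
    orthogonality the right-hand side is strictly smaller than the left. *)
Lemma Fq_orthogonal_perturb n v x : (forall i, (i < n)%N -> v i != 0) ->
  Fq_orthogonal n v -> (forall i, (i < n)%N -> <|v i - x i|> < <|v i|>) ->
  Fq_free n x.
Proof.
move=> v0 vorth vx a a0 i lin; apply/eqP/negPn/negP => ai.
have vp : 0 < <|lincomb n v a|>.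
  by apply: lt_le_trans (vorth a i lin ai); rewrite vf_abs_gt0 v0.
suff : <|lincomb n v a|> < <|lincomb n v a|> by rewrite ltxx.
have {1}-> : lincomb n v a = \sum_(j < n) vf_const C (a j) * (v j - x j).
  by rewrite -[LHS]subr0 -{1}a0 -sumrB; apply: eq_bigr => j _; rewrite mulrBr.
apply: vf_abs_sum_lt => // j _.
have [->|aj] := eqVneq (a j) 0; first by rewrite rmorph0 mul0r vf_abs0.
rewrite vf_absM vf_abs_const // mul1r.
exact: lt_le_trans (vx j (ltn_ord j)) (vorth a j (ltn_ord j) aj).
Qed.

End OrthogonalFamilies.

(** * Additive polynomials and their roots *)

Section AdditivePolynomials.
Variables (R : realType) (F : finFieldType) (C : C_infty R F).
Implicit Types (D E : Ctau C) (y z : C).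
Local Notation q := #|F|.

Definition skew_poly D : {poly C} :=
  \sum_(k < skew_size D) skew_coef D k *: 'X^(q ^ k).

Lemma horner_skew_poly D y : (skew_poly D).[y] = skew_eval D y.
Proof.
rewrite horner_sum; apply: eq_bigr => k _.
by rewrite hornerZ hornerXn iter_frobq.
Qed.

Lemma size_skew_poly_le D n : (skew_size D <= n.+1)%N ->
  (size (skew_poly D) <= (q ^ n).+1)%N.
Proof.
move=> Dn; apply: leq_trans (size_sum _ _ _) _; apply/bigmax_leqP => k _.
rewrite (leq_trans (size_scale_leq _ _)) // size_polyXn ltnS.
by rewrite leq_exp2l ?q_gt1 // -ltnS (leq_trans (ltn_ord k)).
Qed.

Lemma coef_skew_poly D k : (skew_poly D)`_(q ^ k) = skew_coef D k.
Proof.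
rewrite coef_sum; have [Dk|kD] := leqP (skew_size D) k.
  rewrite skew_coef_default // big1 // => i _.
  by rewrite coefZ coefXn eqn_exp2l ?q_gt1 // gtn_eqF ?mulr0 // (leq_trans (ltn_ord i)).
rewrite (bigD1 (Ordinal kD)) //= coefZ coefXn eqxx mulr1 big1 ?addr0 // => i.
by rewrite -val_eqE eq_sym coefZ coefXn eqn_exp2l ?q_gt1 // => /negPf /= ->; rewrite mulr0.
Qed.

Lemma q_eq0 : q%:R = 0 :> C.
Proof.
have [p p_pr pF] := finPcharP F.
have pC : p \in [pchar C] by rewrite (fmorph_pchar (vf_const C)).
have /p_natP[k qE] : p.-nat q.
  by rewrite -cardsT; exact: abelian.abelem_pgroup (abelian.fin_ring_pchar_abelem pF).
apply/eqP; rewrite -(dvdn_pcharf pC) qE.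
by case: k qE (q_gt1 F) => [->//|k _ _]; rewrite expnS dvdn_mulr.
Qed.

Lemma deriv_skew_poly D : (skew_poly D)^`() = (skew_coef D 0)%:P.
Proof.
have dX k : ('X^(q ^ k.+1) : {poly C})^`() = 0.
  by rewrite derivXn expnS -mulr_natr natrM -[q%:R]polyC_natr q_eq0 mul0r mulr0.
rewrite /skew_poly (raddf_sum deriv); case E : (skew_size D) => [|m].
  by rewrite big_ord0 skew_coef_default ?E.
rewrite big_ord_recl /= derivZ expr1 derivX alg_polyC big1 ?addr0 // => i _.
by rewrite derivZ dX scaler0.
Qed.

(* The polynomial of [D] is separable as its derivative is a nonzero constant. *)
Lemma skew_poly_roots D n : skew_size D = n.+1 -> skew_coef D 0 != 0 ->
  exists L : seq C, [/\ uniq L, size L = (q ^ n)%N &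
    forall y, (y \in L) = (skew_eval D y == 0)].
Proof.
move=> Dn D0; have [L pE] := closed_field_poly_normal (skew_poly D).
have Dn0 : skew_coef D n != 0.
  have -> : skew_coef D n = lead_coef (skew_val D) by rewrite lead_coefE -/(skew_size D) Dn.
  by rewrite lead_coef_eq0 -size_poly_eq0 -/(skew_size D) Dn.
have p0 : skew_poly D != 0.
  by apply: contra Dn0 => /eqP p0; rewrite -coef_skew_poly p0 coef0.
have lc0 : lead_coef (skew_poly D) != 0 by rewrite lead_coef_eq0.
exists L; split.
- have : separable_poly (skew_poly D).
    by rewrite unlock deriv_skew_poly -alg_polyC coprimepZr ?coprimep1.
  rewrite pE -mul_polyC separable_mul => /and3P[_ + _].
  by rewrite separable_prod_XsubC.
- have : size (skew_poly D) = (size L).+1.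
    by rewrite pE size_scale // size_prod_XsubC.
  move=> sL; apply/eqP; rewrite eqn_leq -ltnS -sL size_skew_poly_le ?Dn //=.
  rewrite -ltnS -sL ltnNge; apply: contra Dn0 => sp.
  by rewrite -coef_skew_poly nth_default.
- move=> y; rewrite -horner_skew_poly {1}pE hornerZ mulf_eq0 (negPf lc0) /=.
  by rewrite -/(root _ y) root_prod_XsubC.
Qed.

Lemma skew_poly_roots_le D n : D != 0 -> (skew_size D <= n.+1)%N ->
  exists2 L : seq C, (size L <= q ^ n)%N &
    forall y, skew_eval D y = 0 -> y \in L.
Proof.
move=> D0 Dn; have [L pE] := closed_field_poly_normal (skew_poly D).
have p0 : skew_poly D != 0.
  apply: contra D0 => /eqP p0; apply/eqP/skewpolyP => k.
  by rewrite skew_coef0 -coef_skew_poly p0 coef0.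
exists L => [|y /eqP].
  rewrite -ltnS; apply: leq_trans (size_skew_poly_le Dn).
  by rewrite [in leqRHS]pE size_scale ?lead_coef_eq0 // size_prod_XsubC.
by rewrite -horner_skew_poly pE hornerZ mulf_eq0 lead_coef_eq0 (negPf p0) -/(root _ y)
  root_prod_XsubC.
Qed.

Lemma exists_frobq_root z : exists y, frobq y = z.
Proof.
have [y yE] := solve_monicpoly (fun i => if i == 0%N then z else 0) (q_gt0 F).
exists y; rewrite /frobq yE; case: #|F| (q_gt0 F) => // n _.
rewrite big_ord_recl /= expr0 mulr1 big1 ?addr0 // => i _.
by rewrite mul0r.
Qed.

(** Without constant term D factors as tau E, where E has the q-th roots of the coefficients. E has
    the same zeros, but the bound on their number drops from q^n to q^(n - 1) when n > 0 and E is
    nonzero. *)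
Lemma exists_skew_frobq_root D n : skew_coef D 0 = 0 ->
  (skew_size D <= n.+1)%N -> exists E, [/\ (skew_size E <= n)%N,
    forall k, skew_coef D k.+1 = frobq (skew_coef E k) &
    forall y, skew_eval D y = frobq (skew_eval E y)].
Proof.
move=> D0 Dn; have /choice[s sP] := exists_frobq_root.
pose E : Ctau C := SkewPoly (@frobq R F C) (\poly_(i < n) s (skew_coef D i.+1)).
have sE : (skew_size E <= n)%N by exact: size_poly.
have DE k : skew_coef D k.+1 = frobq (skew_coef E k).
  rewrite [skew_coef E k]coef_poly; case: ltnP => [kn|nk]; first by rewrite sP.
  by rewrite rmorph0 skew_coef_default // (leq_trans Dn).
exists E; split => // y.
rewrite (skew_eval_widen _ Dn) (skew_eval_widen _ sE) big_ord_recl D0 mul0r add0r.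
by rewrite rmorph_sum; apply: eq_bigr => i _ /=; rewrite rmorphM /= DE.
Qed.

End AdditivePolynomials.

(** * The isomorphism *)

Section DeRhamIsomorphism.
Variables (R : realType) (F : finFieldType) (C : C_infty R F).
Variables (r : nat) (d : drinfeld_module C r).
Hypothesis r0 : (0 < r)%N.
Implicit Types (w z lambda : C) (D E : Ctau C).
Local Notation q := #|F|.
Local Notation e := (dexp d).

(** The constant term theta of d_theta is nonzero, so the kernel has exactly q^r elements and the
    counting argument provides an orthogonal basis. *)
Lemma torsion_basis : exists v : nat -> C,
  [/\ forall i, (i < r)%N -> skew_eval (d 'X) (v i) = 0,
      forall i, (i < r)%N -> v i != 0,
      Fq_orthogonal r v &
      forall y, skew_eval (d 'X) y = 0 -> exists a, y = lincomb r v a].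
Proof.
have [|L [Luniq sL LE]] := skew_poly_roots (dm_rank d).
  by rewrite dm_theta0 theta_neq0.
have L0 : 0 \in L by rewrite LE raddf0.
have Lst : Fq_stable L.
  move=> y z; rewrite !LE => /eqP y0 /eqP z0 b.
  by rewrite LE Fq_linear_skew_eval y0 z0 mulr0 addr0.
have [v [vL v0 vorth vspan]] := Fq_orthogonal_basis Luniq L0 Lst sL.
exists v; split=> // [i /vL|y /eqP]; first by rewrite LE => /eqP.
by rewrite -LE; exact: vspan.
Qed.

(* If the additive polynomial [D = E^q] had a quasi-periodic function vanishing
   on the lattice, the terms [theta^m D(e(w / theta^m))] with [m > 0] would
   have to cancel the leading term [D v], where [v = e w].  They are smaller
   than the generic absolute value of [D] on the circle through [v], so that
   [v] is close to a root of [E]. *)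
Lemma close_root_of_period (delta : biderivation d) E v :
  (forall y, skew_eval (delta 'X) y = frobq (skew_eval E y)) -> E != 0 ->
  (forall lambda, e lambda = 0 -> F_delta delta lambda = 0) ->
  v != 0 -> skew_eval (d 'X) v = 0 ->
  exists2 x, skew_eval E x = 0 & <|v - x|> < <|v|>.
Proof.
move=> DE E0 F0 v0 dv; have vp : 0 < <|v|> by rewrite vf_abs_gt0.
have [c [ce c0 c1]] := dexp_coefs d.
have [w [ew wdom]] := dexp_surjective ce c0 c1 v.
have t1 := vf_abs_theta_gt1 C; have t0 := lt_trans ltr01 t1.
(* [g j] is the absolute value of the term of index j of E at v; the maximum is the Gauss norm at
   radius |v|. *)
pose g (i : 'I_(skew_size E)) : R := <|skew_coef E i|> * <|v|> ^+ (q ^ i).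
have [i _ imax] : exists2 i, i \in enum 'I_(skew_size E) &
    forall j, j \in enum 'I_(skew_size E) -> g j <= g i.
  have := exists_min_seq (fun j => - g j) (s := enum 'I_(skew_size E)).
  case=> [|i iE imin].
    rewrite -size_eq0 size_enum_ord size_poly_eq0.
    by apply: contra E0 => /eqP E0; apply/eqP/val_inj.
  by exists i => // j /imin; rewrite lerN2.
have {}imax j : g j <= g i by apply: imax; rewrite mem_enum.
have gE (j : 'I_(skew_size E)) : g j = <|(skew_poly E)`_(q ^ j)|> * <|v|> ^+ (q ^ j).
  by rewrite coef_skew_poly.
have gp : 0 < g i.
  have sE : (0 < skew_size E)%N by apply: leq_ltn_trans (ltn_ord i).
  have lE : ((skew_size E).-1 < skew_size E)%N by rewrite prednK.
  apply: lt_le_trans (imax (Ordinal lE)); rewrite mulr_gt0 ?exprn_gt0 //=.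
  rewrite vf_abs_gt0 /skew_coef /skew_size -lead_coefE lead_coef_eq0.
  by rewrite -size_poly_eq0 -lt0n.
have Ev : <|skew_eval E v|> ^+ q <= g i ^+ q / <|theta C|>.
  have -> : <|skew_eval E v|> ^+ q = <|0 - skew_eval (delta 'X) v|>.
    by rewrite sub0r vf_absN DE vf_absX.
  (* At the period theta w the limit is 0 and the first summand is D(v), so the remaining summands
     bound |D(v)|. *)
  have F1 := F_delta_lim delta (theta C * w).
  rewrite F0 in F1; last by rewrite dexp_theta ew dv.
  apply: (converges_to_abs_le (N := 1)) F1 => -[//|n] _.
  rewrite /quasi_sum big_ord_recl /= expr0 mul1r expr1.
  rewrite [theta C * w]mulrC mulfK ?theta_neq0 // ew addrAC subrr add0r.
  apply: vf_abs_sum_le => [|m _].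
    by rewrite divr_ge0 ?exprn_ge0 // ltW.
  have -> : w * theta C / theta C ^+ (bump 0 m).+1 = w / theta C ^+ m.+1.
    by rewrite /bump add1n [theta C ^+ m.+2]exprS invfM mulrA mulfK ?theta_neq0.
  set y := e _; have ym : <|y|> <= <|v|> / <|theta C|> ^+ m.+1.
    exact: (dexp_dominated ce c0 _ wdom).
  have tm : 0 < <|theta C|> ^+ m.+1 by rewrite exprn_gt0.
  have Ey : <|skew_eval E y|> <= g i / <|theta C|> ^+ m.+1.
    apply: vf_abs_sum_le => [|j _]; first by rewrite divr_ge0 // ltW.
    rewrite vf_absM iter_frobq vf_absX.
    apply: (le_trans (y := g j / <|theta C|> ^+ m.+1)); last first.
      by rewrite ler_wpM2r // invr_ge0 ltW.
    rewrite -mulrA ler_wpM2l ?vf_abs_ge0 //.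
    apply: (le_trans (y := (<|v|> / <|theta C|> ^+ m.+1) ^+ (q ^ j))).
      by rewrite lerXn2r // nnegrE ?vf_abs_ge0 // divr_ge0 ?ltW.
    rewrite expr_div_n ler_wpM2l ?exprn_ge0 ?vf_abs_ge0 //.
    rewrite lef_pV2 ?posrE ?exprn_gt0 // -[X in X <= _]expr1.
    by rewrite ler_weXn2l ?exprn_ege1 ?expn_gt0 ?q_gt0 // ltW.
  rewrite vf_absM vf_absX DE vf_absX /bump add1n.
  (* With t = |theta|^(m + 1), this is t (g_i / t)^q = g_i^q / t^(q - 1), at most g_i^q / |theta|
     because q >= 2. *)
  apply: (le_trans (y := <|theta C|> ^+ m.+1 * (g i / <|theta C|> ^+ m.+1) ^+ q)).
    rewrite ler_wpM2l ?(ltW tm) // lerXn2r // nnegrE ?vf_abs_ge0 //.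
    by rewrite divr_ge0 // ltW.
  rewrite expr_div_n mulrCA ler_wpM2l ?exprn_ge0 ?(ltW gp) //.
  have -> : q = q.-1.+1 by rewrite prednK ?q_gt0.
  rewrite [(_ ^+ m.+1) ^+ _]exprS invfM mulVKf ?gt_eqF //.
  have q1 : (0 < q.-1)%N by have := q_gt1 F; case: #|F| => [|[]].
  rewrite lef_pV2 ?posrE ?exprn_gt0 // -exprM -[X in X <= _]expr1.
  by rewrite ler_weXn2l ?ltW // muln_gt0.
have {}Ev : <|skew_eval E v|> < g i.
  have : <|skew_eval E v|> ^+ q < g i ^+ q.
    apply: le_lt_trans Ev _; rewrite ltr_pdivrMr // ltr_pMr ?exprn_gt0 //.
  by rewrite ltr_pXn2r ?q_gt0 // nnegrE ?vf_abs_ge0 // ltW.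
rewrite -horner_skew_poly gE in Ev.
have [x /eqP xE vx] := exists_close_root Ev; exists x => //.
by rewrite -horner_skew_poly.
Qed.

(** If E were nonzero, the roots of E close to an orthogonal basis of the theta-torsion would span
    q^r zeros, more than the degree bound q^(r - 1) allows. *)
Lemma periods_determine_reduced (delta : biderivation d) :
  (skew_size (delta 'X) <= r.+1)%N ->
  (forall lambda, e lambda = 0 -> F_delta delta lambda = 0) -> delta 'X = 0.
Proof.
move=> dr F0; have D0 := bider_coef0 delta 'X.
have [E [Er DEk DE]] := exists_skew_frobq_root D0 dr.
have [E0|E0] := eqVneq E 0.
  by apply/skewpolyP => -[|k]; rewrite skew_coef0 // DEk E0 skew_coef0 rmorph0.
have [v [vV v0 vorth vspan]] := torsion_basis.
have /choice[x xP] : forall i, exists x, (i < r)%N ->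
    skew_eval E x = 0 /\ <|v i - x|> < <|v i|>.
  move=> i; have [ir|ri] := ltnP i r; last by exists 0.
  have [x Ex vx] := close_root_of_period DE E0 F0 (v0 i ir) (vV i ir).
  by exists x.
have xfree : Fq_free r x.
  by apply: Fq_orthogonal_perturb v0 vorth _ => i /xP[].
have [] := @skew_poly_roots_le _ _ _ E r.-1 E0; first by rewrite prednK.
move=> L sL LE; suff : (q ^ r <= q ^ r.-1)%N.
  by rewrite leq_exp2l ?q_gt1 // leqNgt prednK // leqnn.
apply: leq_trans sL; apply: Fq_free_card xfree _ => a; apply: LE.
rewrite raddf_sum big1 // => j _ /=.
have [xj _] := xP j (ltn_ord j).
have := Fq_linear_skew_eval E (a j) (x j) 0.
by rewrite addr0 raddf0 addr0 xj mulr0.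
Qed.

(* Subtracting from [lambda / theta] the combination of the [w_i] with the same
   image under [dexp] gives a period of absolute value at most
   [|lambda| / |theta|]: by orthogonality only [w_i] with
   [|v_i| <= |dexp (lambda / theta)|] occur, and then [|w_i| <= |lambda / theta|]. *)
Lemma lattice_generators : exists l : nat -> C,
  (forall i, (i < r)%N -> e (l i) = 0) /\
  forall lambda, e lambda = 0 -> exists a : nat -> {poly F},
    lambda = \sum_(i < r) A_val C (a i) * l i.
Proof.
have [v [vV v0 vorth vspan]] := torsion_basis.
have [c [ce c0 c1]] := dexp_coefs d.
have /choice[w wP] := dexp_surjective ce c0 c1.
have t1 := vf_abs_theta_gt1 C; have t0 := lt_trans ltr01 t1.
exists (fun i => theta C * w (v i)); split=> [i ir|].
  by rewrite dexp_theta (wP _).1 vV.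
have [eps eps0 small] := no_small_period ce c0 c1.
move=> lambda l0.
(* The descent is on N: each division by theta lowers it by 1, and at N = 0 discreteness of the
   lattice forces lambda = 0. *)
have [N lN] : exists N, <|lambda|> < eps * <|theta C|> ^+ N.
  have [N /(_ N (leqnn N))] := div_theta_small C (vf_abs_ge0 lambda) eps0.
  by rewrite ltr_pdivrMr ?exprn_gt0 // => ?; exists N.
elim: N lambda l0 lN => [|N IH] lambda l0 lN.
  exists (fun=> 0); rewrite (small lambda) //; last by rewrite expr0 mulr1 in lN.
  by rewrite big1 // => i _; rewrite A_val0 mul0r.
set u := lambda / theta C.
have lu : lambda = theta C * u by rewrite mulrC divfK ?theta_neq0.
have [a ua] : exists a, e u = lincomb r v a.
  by apply: vspan; rewrite -dexp_theta -lu.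
pose u' := \sum_(i < r) vf_const C (a i) * w (v i).
have eu' : e u' = e u.
  rewrite ua raddf_sum; apply: eq_bigr => i _ /=.
  have := dexp_lin d (a i) (w (v i)) 0.
  by rewrite addr0 raddf0 addr0 (wP _).1.
have u'u : <|u'|> <= <|u|>.
  apply: vf_abs_sum_le => [|i _]; first exact: vf_abs_ge0.
  have [->|ai] := eqVneq (a i) 0; first by rewrite rmorph0 mul0r vf_abs0 vf_abs_ge0.
  rewrite vf_absM vf_abs_const // mul1r.
  have vu : <|v i|> <= <|e u|> by rewrite ua vorth.
  apply: (dominated_abs_ge ce c0 _ (wP (v i)).2 vu).
  by rewrite -vf_abs_gt0 (lt_le_trans _ vu) // vf_abs_gt0 v0.
have [||b bE] := IH (u - u').
- by rewrite raddfB /= eu' subrr.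
- apply: (le_lt_trans (y := <|u|>)); first exact: vf_absB_le.
  by rewrite vf_absM vf_absV ltr_pdivrMr // -mulrA -exprSr.
(* Here lambda = theta (u - u') + theta u', and theta u' is the combination of the generators with
   constant coefficients a_i. *)
exists (fun i => b i * 'X + (a i)%:P).
rewrite lu -(subrK u' u) bE mulrDr !mulr_sumr -big_split; apply: eq_bigr => i _ /=.
rewrite A_valD A_valM A_valX A_valC mulrDl !mulrA; congr (_ * _ * _ + _ * _).
  exact: mulrC.
exact: mulrC.
Qed.

HB.instance Definition _ := GRing.isLinear.Build C (biderivation d) (HomA d)
  *:%R (@dR_period R F C r d) (@dR_period_is_linear R F C r d).

Lemma HomA_sum n (u : 'I_n -> C) (f : 'I_n -> HomA d) (l : Lambda d) :
  hom_fun (\sum_(k < n) u k *: f k) l = \sum_(k < n) u k * f k l.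
Proof.
elim: n u f => [|n IH] u f; first by rewrite !big_ord0.
by rewrite !big_ord_recr /= -IH.
Qed.

Lemma bider_sum n (u : 'I_n -> C) (delta : 'I_n -> biderivation d) a :
  bider_fun (\sum_(k < n) u k *: delta k) a = \sum_(k < n) u k *: delta k a.
Proof.
elim: n u delta => [|n IH] u delta; first by rewrite !big_ord0.
by rewrite !big_ord_recr /= -IH.
Qed.

Lemma lam_sum n (a : 'I_n -> {poly F}) (l : 'I_n -> Lambda d) :
  lam (\sum_(i < n) a i *: l i) = \sum_(i < n) A_val C (a i) * lam (l i).
Proof.
elim: n a l => [|n IH] a l; first by rewrite !big_ord0.
by rewrite !big_ord_recr /= -IH.
Qed.

Lemma HomA_eq_generators : exists l : 'I_r -> Lambda d,
  forall f g : HomA d, (forall i, f (l i) = g (l i)) -> f = g.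
Proof.
have [l [le lgen]] := lattice_generators.
have lP (i : 'I_r) : period d (l i) by rewrite /period le.
exists (fun i => Period (lP i)) => f g fg; apply: val_inj; apply/funext => x /=.
have [a xE] := lgen _ (eqP (lamP x)).
have {xE} -> : x = \sum_(i < r) a i *: Period (lP i).
  by apply: val_inj; rewrite [LHS]xE [RHS]lam_sum.
have lin (h : HomA d) : h (\sum_(i < r) a i *: Period (lP i)) =
    \sum_(i < r) A_val C (a i) * h (Period (lP i)).
  have /asboolP hlin := homP h.
  have h0 : h 0 = 0.
    by have := hlin (-1) 0 0; rewrite scaler0 addr0 /A_val rmorphN rmorph1
      hornerN hornerC mulN1r addNr.
  by elim/big_rec2: _ => // i y z _ <-; rewrite hlin.
by rewrite !lin; apply: eq_bigr => i _; rewrite fg.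
Qed.

Lemma dR_map_injective : injective (@dR_map R F C r d).
Proof.
apply: raddf_inj => x; have [delta ->] := dR_class_surj x.
have [delta' [-> sz]] := reduced_representative delta r0.
rewrite /= dR_map_class => per0.
have dX : delta' 'X = 0.
  apply: periods_determine_reduced sz _ => lambda l0.
  have lP : period d lambda by apply/eqP.
  by rewrite -[LHS]/(dR_period delta' (Period lP)) per0.
have : dR_class delta' = dR_class 0.
  apply/dR_class_eq; rewrite subr0; apply: (strictly_innerP (n := 0)).
    exact: skew_coef0.
  by rewrite dX mul0r scaler0 subrr.
have /eqP := dR_classD (0 : biderivation d) 0.
by rewrite addr0 -subr_eq0 opprD addNKr oppr_eq0 => /eqP -> ->.
Qed.

(* The [r] biderivations [theta |-> tau ^ k], [1 <= k <= r], have an invertible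
   matrix of values on [r] generators of the lattice. *)
Lemma dR_map_surjective (h : HomA d) : exists x, dR_map x = h.
Proof.
have [l lE] := HomA_eq_generators.
have /choice[delta dE] : forall k : 'I_r, exists delta : biderivation d,
    delta 'X = skew_monomial (@frobq R F C) 1 k.+1.
  by move=> k; apply: biderivation_exists; rewrite skew_monomialE.
pose M := \matrix_(k < r, i < r) (dR_period (delta k) (l i) : C).
have combE (u : 'rV[C]_r) i :
    dR_period (\sum_k u 0 k *: delta k) (l i) = (u *m M) 0 i.
  rewrite linear_sum; under eq_bigr do rewrite linearZ.
  by rewrite HomA_sum mxE; apply: eq_bigr => k _; rewrite mxE.
have sumX (u : 'rV[C]_r) k : skew_coef ((\sum_k u 0 k *: delta k) 'X) k =
    \sum_(i < r) u 0 i * (k == i.+1)%:R.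
  rewrite bider_sum skew_coef_sum; apply: eq_bigr => i _.
  by rewrite skew_coefZ dE skew_monomialE.
(* A row vector killed by M gives a biderivation with zero periods and degree at most r at ['X]. Its
   value at ['X] is therefore 0, and the coefficients there are the entries of the vector. *)
have Mfree : row_free M.
  apply: inj_row_free => u uM;
  have per0 : dR_period (\sum_k u 0 k *: delta k) = 0.
    by apply: lE => i; rewrite combE uM mxE.
  have X0 : (\sum_k u 0 k *: delta k : biderivation d) 'X = 0.
    apply: periods_determine_reduced.
      apply: skew_size_leP => k rk; rewrite sumX big1 // => i _.
      by rewrite gtn_eqF ?mulr0 // (leq_trans _ rk) // ltnS.
    move=> lambda l0; have lP : period d lambda by apply/eqP.
    by rewrite -[LHS]/(dR_period _ (Period lP)) per0.
  apply/rowP => k; rewrite mxE -(skew_coef0 (@frobq R F C) k.+1) -X0 sumX.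
  rewrite (bigD1 k) //= eqxx mulr1 big1 ?addr0 // => i ik.
  by rewrite eqSS eq_sym val_eqE (negPf ik) mulr0.
have Munit : M \in unitmx by rewrite -row_free_unit.
pose hv : 'rV[C]_r := \row_i h (l i).
exists (dR_class (\sum_k (hv *m invmx M) 0 k *: delta k)).
rewrite dR_map_class; apply: lE => i.
by rewrite combE mulmxKV // mxE.
Qed.

End DeRhamIsomorphism.

Theorem corollary3p5 (R : realType) (F : finFieldType) (C : C_infty R F)
  (r : nat) (hr : (2 <= r)%N) (d : drinfeld_module C r) :
  exists DR : {linear H1DR d -> HomA d},
    (forall delta : biderivation d, DR (dR_class delta) = dR_period delta)
    /\ bijective DR.
Proof.
have r0 : (0 < r)%N := ltnW hr.
exists (@dR_map R F C r d); split; first exact: dR_map_class.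
have /choice[g gK] := dR_map_surjective r0 (d := d).
exists g => // x; apply: (dR_map_injective r0); exact: gK.
Qed.
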